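(* Let $f\in\Phi'(\mathbb{R}^n)$, let $\rho(t)$, $t>0$, be an automodel function, let $g\in\Phi'(\mathbb{R}^n)$, and let $\beta\in\mathbb{C}$. Then $$f(x)\stackrel{\Phi'}{\sim}g(x),\quad |x|\to\infty\quad\big(\rho(t)\big)$$ if and only if $$D^{\beta}f(x)\stackrel{\Phi'}{\sim}D^{\beta}g(x),\quad |x|\to\infty\quad\big(t^{-\beta}\rho(t)\big).$$
   Context: Fourier transform: $F[\varphi](\xi)=\int_{\mathbb{R}^n}e^{i\xi\cdot x}\varphi(x)\,d^nx$ for $\varphi$ in the Schwartz space $\mathcal{S}(\mathbb{R}^n)$. Lizorkin spaces: $\Psi(\mathbb{R}^n)=\{\psi\in\mathcal{S}(\mathbb{R}^n):(\partial^{j}\psi)(0)=0 \text{ for all multi-indices } j \text{ with } |j|=0,1,2,\dots\}$ and $\Phi(\mathbb{R}^n)=\{F[\psi]:\psi\in\Psi(\mathbb{R}^n)\}$, with the topology of $\mathcal{S}(\mathbb{R}^n)$; equivalently, $\phi\in\Phi(\mathbb{R}^n)$ iff $\phi\in\mathcal{S}(\mathbb{R}^n)$ and $\int_{\mathbb{R}^n}x^j\phi(x)\,d^nx=0$ for all multi-indices $j$. $\Phi'(\mathbb{R}^n)$ is the space of continuous linear functionals on $\Phi(\mathbb{R}^n)$ (identified with $\mathcal{S}'(\mathbb{R}^n)$ modulo polynomials), with (weak) convergence tested on each element of $\Phi(\mathbb{R}^n)$. For $f\in\Phi'(\mathbb{R}^n)$ and $t>0$, $\langle f(tx),\phi(x)\rangle=t^{-n}\langle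 f(x),\phi(x/t)\rangle$. Riesz fractional operator $D^{\beta}=(-\Delta)^{\beta/2}$, $\beta\in\mathbb{C}$: for $\phi\in\Phi(\mathbb{R}^n)$, $D^{\beta}\phi=\kappa_{-\beta}*\phi$, where $\kappa_\alpha$ is the Riesz kernel: $\kappa_\alpha(x)=|x|^{\alpha-n}/\gamma_n(\alpha)$ with $\gamma_n(\alpha)=2^{\alpha}\pi^{n/2}\Gamma(\alpha/2)/\Gamma((n-\alpha)/2)$ for $\alpha\ne-2s,\ n+2s$ ($|x|^{\alpha-n}$ being defined by analytic continuation in $\alpha$), $\kappa_{-2s}=(-\Delta)^s\delta$, and $\kappa_{n+2s}(x)=(-1)^{s+1}|x|^{2s}\log|x|\big/\big(2^{n+2s-1}\pi^{n/2}s!\,\Gamma(\tfrac n2+s)\big)$, $s=0,1,2,\dots$. Equivalently, $D^{\beta}\phi=F^{-1}\big[|\xi|^{\beta}F[\phi](\xi)\big]$. The operator $D^\beta$ maps $\Phi(\mathbb{R}^n)$ onto itself. For $f\in\Phi'(\mathbb{R}^n)$, $D^{\beta}f$ is defined by $\langle D^{\beta}f,\phi\rangle=\langle f,D^{\beta}\phi\rangle$ for all $\phi\in\Phi(\mathbb{R}^n)$. Automodel (regularly varying) function of degree $\alpha\in\mathbb{R}$: a positive continuous function $\rho$ on $(0,\infty)$ such that $\lim_{t\to\infty}\rho(ta)/\rho(t)=a^{\alpha}$ for every $a>0$; an automodel function is one of some degree $\alpha\in\mathbb{R}$. Quasi-asymptotics at infinity: $f(x)\stackrel{\Phi'}{\sim}g(x)$,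 $|x|\to\infty$ $(\rho(t))$, means that $f(tx)/\rho(t)\to g(x)$ in $\Phi'(\mathbb{R}^n)$ as $t\to\infty$, with $g\not\equiv0$ in $\Phi'(\mathbb{R}^n)$. The same notation and definition are used with the (possibly complex-valued) normalizing function $t^{-\beta}\rho(t)$ in place of $\rho(t)$. *)

(* Defs.v *)
From HB Require Import structures.
From mathcomp Require Import all_boot all_order all_algebra.
From mathcomp Require Import complex.
From mathcomp Require Import all_classical all_reals all_analysis.

Set Implicit Arguments.
Unset Strict Implicit.
Unset Printing Implicit Defensive.

Import Order.TTheory GRing.Theory Num.Theory.
Import numFieldNormedType.Exports.

Local Open Scope classical_set_scope.
Local Open Scope ring_scope.
Local Open Scope complex_scope.

(* Lebesgue measure on R^n, carried by n.-tuple R with the product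
   sigma-algebra: the n-fold product of the Lebesgue measure of the line, i.e.
   the Dirac mass for n = 0, and for n + 1 the product of the measure on R with
   the one on n.-tuple R, transported along (x, t) |-> x :: t. *)
Section lebesgue_tuple.
Variable R : realType.
Local Notation mR := (measurableTypeR R).

Definition tuple_cons n (x : mR * n.-tuple mR) : n.+1.-tuple mR :=
  [tuple of x.1 :: x.2].

Definition tuple_uncons n (t : n.+1.-tuple mR) : mR * n.-tuple mR :=
  (thead t, [tuple of behead t]).

Lemma tuple_consK n : cancel (@tuple_cons n) (@tuple_uncons n).
Proof. by case=> x t; congr pair; apply/val_inj. Qed.

Lemma measurable_tuple_cons n : measurable_fun setT (@tuple_cons n).
Proof. exact: measurable_cons. Qed.

Lemma measurable_tuple_uncons n : measurable_fun setT (@tuple_uncons n).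
Proof.
apply/measurable_fun_pair; first exact: measurable_tnth.
exact: measurable_behead.
Qed.

Section step.
Variables (n : nat) (mu : {sigma_finite_measure set (n.-tuple mR) -> \bar R}).

Definition lebesgue_tuple_step : set (n.+1.-tuple mR) -> \bar R :=
  pushforward (lebesgue_measure \x mu)%E (@tuple_cons n).

Let step0 : lebesgue_tuple_step set0 = 0%E.
Proof. by rewrite /lebesgue_tuple_step /pushforward preimage_set0 measure0. Qed.

Let step_ge0 A : (0 <= lebesgue_tuple_step A)%E.
Proof. by apply: integral_ge0 => x _ /=; exact: measure_ge0. Qed.

Let step_sigma_additive : semi_sigma_additive lebesgue_tuple_step.
Proof.
exact: (@measure_semi_sigma_additive _ _ _
  (measure_function_pushforward__canonical__measure_function_Measure
    (@lebesgue_measure R \x mu)%E (@measurable_tuple_cons n))).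
Qed.

HB.instance Definition _ := isMeasure.Build _ _ _
  lebesgue_tuple_step step0 step_ge0 step_sigma_additive.

Lemma lebesgue_tuple_stepX A B : measurable A -> measurable B ->
  lebesgue_tuple_step (@tuple_uncons n @^-1` (A `*` B)) =
  (lebesgue_measure A * mu B)%E.
Proof.
move=> mA mB; rewrite /lebesgue_tuple_step /pushforward -comp_preimage.
rewrite (_ : _ \o _ = id) ?preimage_id ?product_measure1E//.
by apply/funext => x; exact: tuple_consK.
Qed.

Let sigma_finite_step : sigma_finite setT lebesgue_tuple_step.
Proof.
have /sigma_finiteP[F [TF ndF Foo]] := sigma_finiteT (@lebesgue_measure R).
have /sigma_finiteP[G [TG ndG Goo]] := sigma_finiteT mu.
exists (fun k => @tuple_uncons n @^-1` (F k `*` G k)).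
  rewrite -preimage_bigcup [X in _ @^-1` X](_ : _ = setT) ?preimage_setT//.
  apply/seteqP; split=> // -[x t] _.
  have [i _ Fix] : (\bigcup_i F i) x by rewrite -TF.
  have [j _ Gjt] : (\bigcup_j G j) t by rewrite -TG.
  exists (maxn i j) => //; split => /=.
  - by move: x Fix; exact/subsetPset/ndF/leq_maxl.
  - by move: t Gjt; exact/subsetPset/ndG/leq_maxr.
move=> k; have [mF Fk] := Foo k; have [mG Gk] := Goo k.
have mFG : measurable (F k `*` G k) by exact: measurableX.
split; first by rewrite -[X in measurable X]setTI; exact: measurable_tuple_uncons.
by rewrite lebesgue_tuple_stepX// lte_mul_pinfty// ge0_fin_numE.
Qed.

HB.instance Definition _ := Measure_isSigmaFinite.Build _ _ _
  lebesgue_tuple_step sigma_finite_step.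

End step.

Fixpoint lebesgue_tuple n : {sigma_finite_measure set (n.-tuple mR) -> \bar R} :=
  match n with
  | 0 => \d_ [tuple]
  | m.+1 => lebesgue_tuple_step (lebesgue_tuple m)
  end.
End lebesgue_tuple.

Section calculus.
Variables (R : realType) (n : nat).
Implicit Types (u : 'rV[R]_n -> R) (phi : 'rV[R]_n -> R[i]).

Definition integral_Rn phi : R[i] :=
  let int u := (\int[lebesgue_tuple R n]_t u (\row_j tnth t j))%R in
  int (fun x => complex.Re (phi x)) +i* int (fun x => complex.Im (phi x)).

Definition dotprod (x y : 'rV[R]_n) : R := \sum_(j < n) x 0 j * y 0 j.

(* The norm that the library puts on 'rV[R]_n is the maximum norm. *)
Definition enorm (x : 'rV[R]_n) : R := Num.sqrt (dotprod x x).

Definition expi (t : R) : R[i] := cos t +i* sin t.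

(* t^b = exp (b ln t); it is used for t > 0 only, up to a null set. *)
Definition cpow (t : R) (b : R[i]) : R[i] :=
  (t `^ complex.Re b)%:C * expi (complex.Im b * ln t).

Definition monomial (j : 'I_n -> nat) (x : 'rV[R]_n) : R :=
  \prod_(i < n) x 0 i ^+ j i.

Definition partial (i : 'I_n) u : 'rV[R]_n -> R := 'D_(delta_mx 0 i) u.

Definition mpartial_real (k : 'I_n -> nat) u : 'rV[R]_n -> R :=
  foldr (fun i => iter (k i) (partial i)) u (enum 'I_n).

Definition mpartial (k : 'I_n -> nat) phi : 'rV[R]_n -> R[i] := fun x =>
  mpartial_real k (fun y => complex.Re (phi y)) x +i*
  mpartial_real k (fun y => complex.Im (phi y)) x.

(* All iterated partial derivatives, in any order, exist and are continuous. *)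
Definition smooth_real u : Prop := forall s : seq 'I_n,
  let v := foldr partial u s in
  continuous v /\ forall x i, derivable v x (delta_mx 0 i).

Definition smooth phi : Prop :=
  smooth_real (fun x => complex.Re (phi x)) /\
  smooth_real (fun x => complex.Im (phi x)).

End calculus.

Section Lizorkin.
Variables (R : realType) (n : nat).
Implicit Types (phi psi : 'rV[R]_n -> R[i]).
Implicit Types (f g : ('rV[R]_n -> R[i]) -> R[i]).

Definition Schwartz : set ('rV[R]_n -> R[i]) := [set phi | smooth phi /\
  forall j k : 'I_n -> nat, exists M : R,
    forall x, `|(monomial j x)%:C * mpartial k phi x| <= M%:C].

Definition Fourier phi : 'rV[R]_n -> R[i] := fun xi =>
  integral_Rn (fun x => expi (dotprod xi x) * phi x).

Definition inv_Fourier psi : 'rV[R]_n -> R[i] := fun x =>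
  ((2 * pi) ^- n)%:C *
  integral_Rn (fun xi => expi (- dotprod x xi) * psi xi).

Definition Lizorkin_Psi : set ('rV[R]_n -> R[i]) :=
  [set psi | Schwartz psi /\ forall k : 'I_n -> nat, mpartial k psi 0 = 0].

Definition Lizorkin_Phi : set ('rV[R]_n -> R[i]) := Fourier @` Lizorkin_Psi.

(* The neighbourhoods of phi in the topology of the Schwartz space, generated
   by the seminorms sup_x |x^j (D^k phi)(x)|. *)
Definition Schwartz_ball phi (m : nat) (e : R) : set ('rV[R]_n -> R[i]) :=
  [set psi | forall j k : 'I_n -> nat,
    (\sum_i j i <= m)%N -> (\sum_i k i <= m)%N ->
    forall x, `|(monomial j x)%:C * mpartial k (fun y => psi y - phi y) x|
              <= e%:C].

Definition Schwartz_nbhs phi : set_system ('rV[R]_n -> R[i]) :=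
  filter_from [set p : nat * R | 0 < p.2] (fun p => Schwartz_ball phi p.1 p.2).

(* Elements of Phi' are represented by functions on all of 'rV[R]_n -> R[i]
   that are linear and continuous on Phi; their values off Phi are irrelevant. *)
Definition Lizorkin_dual : set (('rV[R]_n -> R[i]) -> R[i]) := [set f |
  (forall (a b : R[i]) phi psi, Lizorkin_Phi phi -> Lizorkin_Phi psi ->
     f (fun x => a * phi x + b * psi x) = a * f phi + b * f psi) /\
  (forall phi, Lizorkin_Phi phi ->
     f psi @[psi --> within Lizorkin_Phi (Schwartz_nbhs phi)] -->
       (f phi : R[i]^o))].

(* (-Delta)^(b/2) as a Fourier multiplier; on Phi this is the convolution with
   the Riesz kernel of order -b. *)
Definition Riesz (b : R[i]) phi : 'rV[R]_n -> R[i] :=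
  inv_Fourier (fun xi => cpow (enorm xi) b * Fourier phi xi).

Definition Riesz_dual (b : R[i]) f : ('rV[R]_n -> R[i]) -> R[i] :=
  fun phi => f (Riesz b phi).

(* The functional f(t x), defined by duality from the change of variable
   x |-> x / t. *)
Definition dilation (t : R) f : ('rV[R]_n -> R[i]) -> R[i] :=
  fun phi => (t ^- n)%:C * f (fun x => phi (t^-1 *: x)).

Definition quasi_asymptotic f g (c : R -> R[i]) : Prop :=
  (exists2 phi, Lizorkin_Phi phi & g phi != 0) /\
  (forall phi, Lizorkin_Phi phi ->
     dilation t f phi / c t @[t --> +oo] --> (g phi : R[i]^o)).

End Lizorkin.

Definition automodel_of_degree (R : realType) (a : R) (rho : R -> R) : Prop :=
  [/\ forall t, 0 < t -> 0 < rho t,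
      {within `]0, +oo[, continuous rho} &
      forall s, 0 < s -> rho (t * s) / rho t @[t --> +oo] --> s `^ a].

Definition automodel (R : realType) (rho : R -> R) : Prop :=
  exists a : R, automodel_of_degree a rho.

(* Main.v *)
Require Import Defs.
From mathcomp Require Import all_boot all_order all_algebra.
From mathcomp Require Import complex.
From mathcomp Require Import all_classical all_reals all_analysis.
From mathcomp Require Import measurable_realfun ring lra.

Set Implicit Arguments.
Unset Strict Implicit.
Unset Printing Implicit Defensive.

Import Order.TTheory GRing.Theory Num.Theory.
Import numFieldNormedType.Exports.

Local Open Scope classical_set_scope.
Local Open Scope ring_scope.
Local Open Scope complex_scope.

(** The Riesz operator of order b is a bijection of the Lizorkin space Phi, and
it is homogeneous: it sends phi (x / t) to t^(-b) times the value at x / t of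
its action on phi.  Since a functional of Phi' is linear, the quotient of the
dilated D^b f by t^(-b) rho(t), tested on phi, is therefore equal to the
quotient of the dilated f by rho(t), tested on D^b phi.  As D^b phi runs over
all of Phi, the two families of limits are the same, and D^b g vanishes on Phi
exactly when g does.

Bijectivity and homogeneity are both read off on the Fourier side from
[Riesz_Fourier]: on F psi, with psi in Psi, the operator is the multiplication
of psi by |xi|^b.  Two facts carry this identity.

The first is Fourier inversion, F (F psi) = (2 pi)^n psi(-.), proved as
[Fourier_inversion].  Everything is reduced to the real transforms
int cos(xi . x + d) u(x) dx with an arbitrary phase d, which produce the real
and imaginary parts of F and behave well under induction on the dimension.
The regulariser is the product of the exp(-|x_i|), whose transform is the
product of the 2 / (1 + xi_i^2); the latter has integral (2 pi)^n, hence its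
rescalings form an approximate identity ([cosine_inversion]).  Dominated
convergence needs the transform itself to be integrable, which holds because
applying 1 - d_i^2 to u, where d_i is the i-th partial derivative, multiplies it
by 1 + xi_i^2 ([cosine_transform_cauchy_bounded]).

The second is the stability of Psi under multiplication by |xi|^b
([power_mul_Psi]).  A function of Psi is smaller than every power of |xi|, both
near the origin and at infinity; hence |xi|^a cos(c ln |xi| + d) h(xi) is
bounded and vanishes at the origin for all a, c, d.  The partial derivatives of
such products are sums of such products, so all of them are smooth, rapidly
decreasing and flat at the origin ([flat_oscillating_power]). *)

(** * Rows, tuples and measurability *)

Section rows.
Variable R : realType.
Local Notation mR := (measurableTypeR R).

Definition row_of_tuple n (t : n.-tuple mR) : 'rV[R]_n := \row_j tnth t j.

Definition tuple_of_row n (v : 'rV[R]_n) : n.-tuple mR := [tuple v 0 i | i < n].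

(** Prepending a coordinate to a row; this is how rows follow the recursive
definition of the measure on tuples. *)
Definition cons_row n (x : R) (v : 'rV[R]_n) : 'rV[R]_n.+1 :=
  \row_j oapp (v 0) x (unlift ord0 j).

Definition behead_row n (v : 'rV[R]_n.+1) : 'rV[R]_n := \row_j v 0 (lift ord0 j).

Lemma tuple_of_rowK n : cancel (@tuple_of_row n) (@row_of_tuple n).
Proof. by move=> v; apply/rowP => i; rewrite mxE tnth_mktuple. Qed.

Lemma cons_row0 n x (v : 'rV[R]_n) : cons_row x v 0 ord0 = x.
Proof. by rewrite mxE unlift_none. Qed.

Lemma cons_rowS n x (v : 'rV[R]_n) j : cons_row x v 0 (lift ord0 j) = v 0 j.
Proof. by rewrite mxE liftK. Qed.

Lemma cons_row_behead n (v : 'rV[R]_n.+1) : cons_row (v 0 ord0) (behead_row v) = v.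
Proof.
apply/rowP => j; rewrite mxE; case: unliftP => [k|] -> //=.
by rewrite mxE.
Qed.

Lemma row_of_tuple_cons n x (t : n.-tuple mR) :
  row_of_tuple (tuple_cons (x, t)) = cons_row x (row_of_tuple t).
Proof.
apply/rowP => j; rewrite !mxE; case: unliftP => [k|] -> /=.
  by rewrite tnthS mxE.
by rewrite tnth0.
Qed.

Definition row_measurable n d (T : measurableType d) (u : 'rV[R]_n -> T) :=
  measurable_fun setT (u \o @row_of_tuple n).

Lemma row_measurable_comp n d d' (S : measurableType d) (T : measurableType d')
    (u : 'rV[R]_n -> T) (h : S -> 'rV[R]_n) :
  row_measurable u -> (forall i, measurable_fun setT (fun s => h s 0 i : mR)) ->
  measurable_fun setT (u \o h).
Proof.
move=> mu mh; rewrite (_ : _ \o _ = (u \o @row_of_tuple n) \o (@tuple_of_row n \o h)).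
  apply: measurableT_comp => //; apply/measurable_fun_tnthP => i.
  by rewrite (_ : _ \o _ = fun s => h s 0 i)//; apply/funext => s /=; rewrite tnth_mktuple.
by apply/funext => s /=; rewrite tuple_of_rowK.
Qed.

Lemma row_measurable_coord n (i : 'I_n) :
  row_measurable (fun v : 'rV[R]_n => v 0 i : mR).
Proof.
rewrite /row_measurable (_ : _ \o _ = fun t => tnth t i); first exact: measurable_tnth.
by apply/funext => t; rewrite /= mxE.
Qed.

End rows.

Section row_continuous.
Variable R : realType.
Local Notation mR := (measurableTypeR R).

Lemma row_normP n (v : 'rV[R]_n) (r : R) : 0 < r ->
  (`|v| < r) <-> (forall i, `|v 0 i| < r).
Proof.
move=> r0; rewrite [`|v|]mx_normrE; split=> [/bigmax_ltP[_ h] i|h].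
  exact: (h (0, i)).
by apply/bigmax_ltP; split => // -[i j] _; rewrite (ord1 i); exact: h.
Qed.

Lemma row_normPle n (v : 'rV[R]_n) (r : R) : 0 <= r ->
  (`|v| <= r) <-> (forall i, `|v 0 i| <= r).
Proof.
move=> r0; rewrite [`|v|]mx_normrE; split=> [/bigmax_leP[_ h] i|h].
  exact: (h (0, i)).
by apply/bigmax_leP; split => // -[i j] _; rewrite (ord1 i); exact: h.
Qed.

(** An open set of rows is the union of the countably many boxes with rational
centre and radius 1 / (m + 1) that it contains. *)
Lemma row_open_measurable n (U : set 'rV[R]_n) : open U ->
  measurable ((@row_of_tuple R n) @^-1` U).
Proof.
move=> oU.
pose box (p : 'rV[rat]_n * nat) : set 'rV[R]_n :=
  [set v | forall i, `|v 0 i - ratr (p.1 0 i)| < p.2.+1%:R^-1].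
pose F p := if `[< box p `<=` U >] then (@row_of_tuple R n) @^-1` (box p) else set0.
have -> : (@row_of_tuple R n) @^-1` U = \bigcup_(p in [set: 'rV[rat]_n * nat]) F p.
  apply/seteqP; split => [t Ut|t [p _]]; last first.
    by rewrite /F; case: asboolP => // + /=; exact.
  have /nbhs_ballP[e /= e0 eU] := open_nbhs_nbhs (conj oU Ut).
  have [m _ /(_ m (leqnn m)) me] : \forall m \near \oo, m.+1%:R^-1 < e / 2.
    by near=> m; near: m; apply: near_infty_natSinv_lt (PosNum (divr_gt0 e0 _)).
  have hq i : exists q : rat, `|tnth t i - ratr q| < m.+1%:R^-1.
    have : tnth t i - m.+1%:R^-1 < tnth t i + m.+1%:R^-1.
      by rewrite ltrD2l gtrN// invr_gt0.
    move=> /rat_in_itvoo[q]; rewrite in_itv/= => /andP[q1 q2]; exists q.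
    by rewrite distrC ltr_distl; rewrite q1 q2.
  have [q hq'] := choice hq.
  exists (\row_i q i, m) => //; rewrite /F asboolT => /= [i|v vb].
    by rewrite !mxE.
  apply: eU; rewrite -ball_normE /=; apply/row_normP => // i.
  have := vb i; have := hq' i; rewrite /= !mxE => h1 h2.
  rewrite (_ : _ - _ = (tnth t i - ratr (q i)) - (v 0 i - ratr (q i))); last by ring.
  apply: le_lt_trans (ler_normB _ _) _.
  by rewrite (splitr e) ltrD// (lt_trans _ me).
apply: countable_bigcupT_measurable => [|p]; [exact: countableP|rewrite /F].
case: asboolP => // _.
rewrite (_ : _ @^-1` _ = \bigcap_(i in [set: 'I_n])
    ((fun t : n.-tuple mR => tnth t i) @^-1` ball (ratr (p.1 0 i) : R) p.2.+1%:R^-1)).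
  apply: fin_bigcap_measurable => // i _; rewrite -[X in measurable X]setTI.
  apply: measurable_tnth => //; apply: open_measurable; exact: ball_open.
apply/seteqP; split => t /=.
  by move=> h i _ /=; have := h i; rewrite mxE -ball_normE /= distrC.
by move=> h i; have := h i Logic.I; rewrite mxE -ball_normE /= distrC.
Unshelve. all: by end_near.
Qed.

Lemma continuous_row_measurable n (u : 'rV[R]_n -> R) :
  continuous u -> row_measurable u.
Proof.
move=> /continuousP cu; apply: (measurability _ (@RGenOpens.measurableE R)).
move=> _ [_ [a [b ->] <-]]; rewrite setTI comp_preimage.
apply: row_open_measurable; apply: cu; exact: interval_open.
Qed.

End row_continuous.

(** * Integration over tuples *)

Section row_integral.
Variable R : realType.
Local Notation mR := (measurableTypeR R).
Local Notation mu := (@lebesgue_measure R).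
Local Notation lam n := (lebesgue_tuple R n).

(** In dimension 0 the measure is a Dirac mass. *)
Lemma integral_lebesgue_tuple0 (u : 'rV[R]_0 -> \bar R) : row_measurable u ->
  (\int[lam 0]_t u (row_of_tuple t) = u 0%R)%E.
Proof.
move=> mu0.
have h : (\int[\d_ ([tuple] : 0.-tuple mR)]_t u (row_of_tuple t) = u 0%R)%E.
  rewrite integral_dirac//= diracT mul1e; congr u.
  by apply/rowP => -[].
exact: h.
Qed.

Lemma row_measurable_cons n d (T : measurableType d) (u : 'rV[R]_n.+1 -> T) :
  row_measurable u ->
  measurable_fun setT (fun p : mR * n.-tuple mR => u (cons_row p.1 (row_of_tuple p.2))).
Proof.
move=> mu0; rewrite (_ : (fun p => _) = (u \o @row_of_tuple R n.+1) \o @tuple_cons R n).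
  exact: measurableT_comp mu0 (@measurable_tuple_cons R n).
by apply/funext => -[x t]; rewrite /= row_of_tuple_cons.
Qed.

Lemma row_measurable_consr n d (T : measurableType d) (u : 'rV[R]_n.+1 -> T) x :
  row_measurable u -> row_measurable (fun v => u (cons_row x v)).
Proof.
move=> /row_measurable_cons mu0.
exact: (measurableT_comp mu0 (@pair1_measurable _ _ mR (n.-tuple mR) x)).
Qed.

(** The measure on (n+1)-tuples is an image of a product measure, so that
Tonelli's theorem allows induction on the dimension. *)
Lemma ge0_integral_lebesgue_tupleS n (u : 'rV[R]_n.+1 -> \bar R) :
  row_measurable u -> (forall v, 0 <= u v)%E ->
  (\int[lam n.+1]_t u (row_of_tuple t) =
   \int[mu]_x \int[lam n]_t u (cons_row x (row_of_tuple t)))%E.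
Proof.
move=> mu0 u0.
(* The measure of the (n+1)-tuples unfolds to this pushforward. *)
pose push_ := measure_function_pushforward__canonical__measure_function_Measure
  (mu \x lam n)%E (@measurable_tuple_cons R n).
transitivity (\int[push_]_t u (row_of_tuple t))%E.
  by apply: eq_measure_integral => A _ _.
have := @ge0_integral_pushforward _ _ _ _ R _ (@measurable_tuple_cons R n)
  (mu \x (lam n))%E setT (u \o @row_of_tuple R n.+1) measurableT mu0.
move=> /(_ (fun y _ => u0 _)) h; apply: (eq_trans h).
rewrite preimage_setT.
transitivity (\int[(mu \x lam n)%E]_p u (cons_row p.1 (row_of_tuple p.2)))%E.
  by apply: eq_integral => -[x t] _; rewrite /= row_of_tuple_cons.
exact: (@fubini_tonelli1 _ _ _ _ _ mu (lam n) (fun p => u (cons_row p.1 (row_of_tuple p.2)))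
   (row_measurable_cons mu0) (fun=> u0 _)).
Qed.

(** Both sides are measures which agree on the half-open intervals. *)
Lemma lebesgue_measure_affine (a b : R) (A : set mR) : 0 < a -> measurable A ->
  (a%:E * mu ((fun x => a * x + b)%R @^-1` A) = mu A)%E.
Proof.
move=> a0 mA.
have mf : measurable_fun setT (fun x : mR => a * x + b : mR).
  by apply: continuous_measurable_fun => x; apply: cvgD; [exact: mulrl_continuous|exact: cvg_cst].
pose push_ := (measure_function_pushforward__canonical__measure_function_Measure mu mf).
pose m : {measure set mR -> \bar R} := mscale (NngNum (ltW a0)) push_.
apply/esym; apply: (@lebesgue_measure_unique R m) => // _ [[c d]] _ <-.
rewrite /m /= /mscale /= /pushforward.
have -> : (fun x : mR => (a * x + b)%R) @^-1` `]c, d] = `](c - b) / a, (d - b) / a]%classic.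
  apply/seteqP; split => x /=; rewrite !in_itv /= ltr_pdivrMr// ler_pdivlMr//;
    by rewrite ltrBlDr lerBrDr (mulrC a).
rewrite !lebesgue_measure_itv /= !lte_fin ltr_pM2r ?invr_gt0// ltrD2r.
case: ifPn => cd; last by rewrite mule0.
by rewrite -!EFinD -EFinM; congr EFin; field; rewrite gt_eqF.
Qed.

(** A negative slope is reduced to a positive one by a reflection. *)
Lemma ge0_integral_affine (a b : R) (f : R -> \bar R) : a != 0 ->
  measurable_fun setT (f : mR -> \bar R) -> (forall x, 0 <= f x)%E ->
  (\int[mu]_x f (a * x + b)%R = `|a|^-1%:E * \int[mu]_x f x)%E.
Proof.
wlog a0 : a b f / 0 < a => [H a0 mf f0|].
  have [a0'|a0'|a0'] := ltgtP 0 a; first exact: H; last by rewrite -a0' eqxx in a0.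
  have mN : measurable_fun setT (-%R : mR -> mR) by exact: oppr_measurable.
  have mg : measurable_fun setT (fun x : mR => f (- x)) by exact: measurableT_comp mf mN.
  have := H (- a) (- b) (fun x => f (- x)).
  rewrite oppr_gt0 oppr_eq0 normrN => /(_ a0' a0 mg (fun=> f0 _)).
  under eq_integral do rewrite mulNr -opprD opprK.
  move=> ->; congr (_ * _)%E.
  have := @ge0_integral_pushforward _ _ _ _ R _ mN mu setT f measurableT mf (fun y _ => f0 y).
  rewrite preimage_setT => <-; apply: eq_measure_integral => A mA _.
  exact: lebesgue_measureN.
move=> _ mf f0.
have mF : measurable_fun setT (fun x : mR => a * x + b : mR).
  by apply: continuous_measurable_fun => x; apply: cvgD; [exact: mulrl_continuous|exact: cvg_cst].
have := @ge0_integral_pushforward _ _ _ _ R _ mF mu setT f measurableT mf (fun y _ => f0 y).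
rewrite preimage_setT => h; rewrite -[LHS]h gtr0_norm//.
pose push_ := (measure_function_pushforward__canonical__measure_function_Measure mu mF).
have ia0 : 0 <= a^-1 by rewrite invr_ge0 ltW.
rewrite -(@ge0_integral_mscale _ _ R mu setT measurableT (NngNum ia0) f)//.
apply: eq_measure_integral => A mA _.
have hA := lebesgue_measure_affine b a0 mA.
transitivity (a^-1%:E * mu (A : set mR))%E; last by [].
rewrite -hA muleA -EFinM mulVf ?mul1e//.
by rewrite gt_eqF.
Qed.

End row_integral.

Section row_affine.
Variable R : realType.
Local Notation mR := (measurableTypeR R).
Local Notation mu := (@lebesgue_measure R).
Local Notation lam n := (lebesgue_tuple R n).

Lemma row_measurable_affine n d (T : measurableType d) (u : 'rV[R]_n -> T) (a : R) b :
  row_measurable u -> row_measurable (fun v => u (a *: v + b)).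
Proof.
move=> mu0.
apply: (row_measurable_comp (h := fun t : n.-tuple mR => a *: row_of_tuple t + b)) => // i.
under eq_fun do rewrite !mxE.
by apply: measurable_funD => //; apply: measurable_funM => //; exact: measurable_tnth.
Qed.

Lemma affine_cons_row n (a : R) (b : 'rV[R]_n.+1) x v :
  a *: cons_row x v + b = cons_row (a * x + b 0 ord0) (a *: v + behead_row b).
Proof.
by apply/rowP => j; rewrite !mxE; case: unliftP => [k|] -> //=; rewrite !mxE.
Qed.

(** Induction on the dimension: the affine map acts coordinate by coordinate. *)
Lemma ge0_integral_row_affine n (u : 'rV[R]_n -> \bar R) (a : R) b : a != 0 ->
  row_measurable u -> (forall v, 0 <= u v)%E ->
  (\int[lam n]_t u (a *: row_of_tuple t + b)%R =
   (`|a| ^- n)%:E * \int[lam n]_t u (row_of_tuple t))%E.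
Proof.
move=> a0; elim: n u b => [|n IH] u b mu0 u0.
  rewrite expr0 invr1 mul1e (integral_lebesgue_tuple0 mu0).
  rewrite (@integral_lebesgue_tuple0 R (fun v => u (a *: v + b)%R)).
    by congr u; apply/rowP => -[].
  exact: row_measurable_affine.
have mt := row_measurable_affine a b mu0.
rewrite (ge0_integral_lebesgue_tupleS mu0)//.
rewrite (@ge0_integral_lebesgue_tupleS R n (fun v => u (a *: v + b)%R))//.
pose G x := (\int[lam n]_t u (cons_row x (row_of_tuple t)))%E.
have mG : measurable_fun setT (G : mR -> \bar R).
  exact: (@measurable_fun_fubini_tonelli_F _ _ _ _ R (lam n) _
     (row_measurable_cons mu0) (fun=> u0 _)).
have G0 x : (0 <= G x)%E by apply: integral_ge0.
have ian : (0 <= (`|a| ^- n)%:E)%E by rewrite lee_fin invr_ge0 exprn_ge0.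
transitivity (\int[mu]_x ((`|a| ^- n)%:E * G (a * x + b 0 ord0)%R))%E.
  apply: eq_integral => x _.
  rewrite -(IH (fun v => u (cons_row (a * x + b 0 ord0) v)) (behead_row b))//; last first.
    exact: row_measurable_consr.
  by apply: eq_integral => t _; rewrite affine_cons_row.
rewrite ge0_integralZl//; last first.
  apply: (measurableT_comp mG); apply: continuous_measurable_fun => x.
  by apply: cvgD; [exact: mulrl_continuous|exact: cvg_cst].
rewrite ge0_integral_affine// muleA -EFinM; congr (_%:E * _)%E.
by rewrite exprSr invfM mulrC.
Qed.

Lemma integrable_row_affine n (u : 'rV[R]_n -> R) (a : R) b : a != 0 ->
  (lam n).-integrable setT (fun t => (u (row_of_tuple t))%:E) ->
  (lam n).-integrable setT (fun t => (u (a *: row_of_tuple t + b))%:E).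
Proof.
move=> a0 /integrableP[mu0 iu]; apply/integrableP; split.
  exact: (row_measurable_affine (u := fun v => (u v)%:E)).
rewrite (@ge0_integral_row_affine n (fun v => `|(u v)%:E|%E))//.
  by rewrite lte_mul_pinfty// lee_fin invr_ge0 exprn_ge0.
by apply: measurableT_comp mu0.
Qed.

Lemma Rintegral_row_affine n (u : 'rV[R]_n -> R) (a : R) b : a != 0 ->
  (lam n).-integrable setT (fun t => (u (row_of_tuple t))%:E) ->
  (\int[lam n]_t u (a *: row_of_tuple t + b) =
   `|a| ^- n * \int[lam n]_t u (row_of_tuple t)).
Proof.
move=> a0 iu; have iua := integrable_row_affine b a0 iu.
have /integrableP[mE _] := iu.
have ian : 0 <= `|a| ^- n by rewrite invr_ge0 exprn_ge0.
have mp : row_measurable (fun v => maxe (u v)%:E 0%E).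
  by apply: measurable_maxe => //; exact: mE.
have mn : row_measurable (fun v => maxe (- (u v)%:E)%E 0%E).
  apply: measurable_maxe => //; apply: measurableT_comp => //; exact: mE.
have hp := ge0_integral_row_affine b a0 mp (fun=> _).
have hn := ge0_integral_row_affine b a0 mn (fun=> _).
rewrite /Rintegral -[X in _ = X * _]/(fine (`|a| ^- n)%:E) -fineM//; last exact: integrable_fin_num.
congr fine; rewrite integralE [in RHS]integralE.
under [X in (X - _)%E = _]eq_integral do rewrite funeposE.
under [X in (_ - X)%E = _]eq_integral do rewrite funenegE.
rewrite hp ?hn; [|by move=> v; rewrite le_max lexx orbT..].
rewrite [RHS]muleBr//; last first.
  apply: fin_num_adde_defl; rewrite fin_numN.
    exact: integrable_neg_fin_num.
congr (_ * _ - _ * _)%E; apply: eq_integral => t _; by rewrite ?funeposE ?funenegE.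
Qed.

End row_affine.

(** * Derivatives along a line and integrals over the real line *)

Section derive_rules.
Variables (R : realType) (V : normedModType R).
Implicit Types (f g : V -> R) (x v : V).

(** Derivatives in a given direction are derivatives of one real variable, for
which the chain rule and the mean value theorem are at hand. *)
Lemma is_derive_lineP f x v (df : R) :
  is_derive x v f df <-> is_derive (0 : R) 1 (fun h : R => f (h *: v + x)) df.
Proof.
have hE : (fun h : R => h^-1 *: ((f \o shift x) (h *: v) - f x)) =
  (fun h : R => h^-1 *: (((fun h : R => f (h *: v + x)) \o shift 0) (h *: 1) -
     f (0 *: v + x))).
  by apply/funext => h /=; rewrite scale0r add0r addr0 [h *: 1]mulr1.
by split=> -[d <-]; split; rewrite ?/derivable ?/derive ?hE -?hE// /derivable ?hE// -hE.
Qed.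

(** The rules below restate the calculus rules for functions given by an
expression of their argument, so that they can be chained by unification. *)
Lemma is_derive_add f g x v (df dg : R) : is_derive x v f df ->
  is_derive x v g dg -> is_derive x v (fun y => f y + g y) (df + dg).
Proof. exact: is_deriveD. Qed.

Lemma is_derive_mul f g x v (df dg : R) : is_derive x v f df ->
  is_derive x v g dg -> is_derive x v (fun y => f y * g y) (f x * dg + g x * df).
Proof. exact: is_deriveM. Qed.

Lemma is_derive_mull f x v (c df : R) : is_derive x v f df ->
  is_derive x v (fun y => c * f y) (c * df).
Proof. exact: is_deriveZ. Qed.

Lemma is_derive_opp f x v (df : R) : is_derive x v f df ->
  is_derive x v (fun y => - f y) (- df).
Proof. exact: is_deriveN. Qed.

Lemma is_derive_const x v (c : R) : is_derive x v (fun _ => c) 0.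
Proof. exact: is_derive_cst. Qed.

Lemma is_derive_chain f (h : R -> R) x v (df dh : R) :
  is_derive (f x) 1 h dh -> is_derive x v f df ->
  is_derive x v (fun y => h (f y)) (dh * df).
Proof.
move=> hh /is_derive_lineP hf; apply/is_derive_lineP.
apply: (@is_derive1_comp R h (fun k : R => f (k *: v + x)) 0) => //.
by rewrite scale0r add0r.
Qed.

End derive_rules.

Section line_integrals.
Variable R : realType.
Local Notation mu := (@lebesgue_measure R).

Lemma is_derive_affine (a b x : R) : is_derive x 1 (fun y => a * y + b) a.
Proof.
have h := is_derive_add (is_derive_mull a (is_derive_id x (1 : R))) (is_derive_const x (1:R) b).
by move: h; rewrite mulr1 addr0.
Qed.

(** The line is folded onto the half-line of nonnegative reals, where F is a
primitive of the folded integrand. *)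
Lemma ge0_integral_fold_FTC (f F : R -> R) (l : R) : (forall x, 0 <= f x) ->
  continuous f -> continuous F ->
  (forall x : R, 0 < x -> is_derive x 1 F (f x + f (- x))) ->
  F x @[x --> +oo%R] --> l ->
  (\int[mu]_x (f x)%:E = (l - F 0)%:E)%E.
Proof.
move=> f0 cf cF dF Fl.
have mf : measurable_fun [set: R] f by exact: continuous_measurable_fun.
have cN : continuous (fun x => f (- x)).
  by move=> x; apply: (@continuous_comp _ _ _ -%R f); [exact: oppr_continuous|exact: cf].
have mposnums : measurable [set x : R | 0 <= x]%R by rewrite -set_itvcy.
rewrite -(setUv [set x : R | 0 <= x]%R) ge0_integral_setU//= ; last 4 first.
  exact: measurableC.
  by apply/measurable_EFinP; rewrite setUv.
  by move=> x _; rewrite lee_fin.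
  exact/disj_setPCl.
rewrite -set_itvcy// setCitvr.
rewrite integral_itv_bndo_bndc; last exact/measurable_EFinP/measurable_funTS.
rewrite -{2}oppr0 ge0_integration_by_substitutionNy//; last exact: continuous_subspaceT.
rewrite -ge0_integralD//=; first last.
- apply/measurable_EFinP; apply: (@measurable_funTS _ _ (measurableTypeR R) (measurableTypeR R)).
  exact: continuous_measurable_fun.
- by move=> x _; rewrite lee_fin.
- exact/measurable_EFinP/measurable_funTS.
- by move=> x _; rewrite lee_fin.
under eq_integral do rewrite -EFinD.
rewrite (@ge0_continuous_FTC2y R _ F 0 l)//.
- by move=> x _; rewrite addr_ge0.
- by apply: continuous_subspaceT => x; apply: cvgD; [exact: cf|exact: cN].
- by move=> x x0; have [] := dF _ x0.
- by apply: cvg_at_right_filter; exact: cF.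
- by move=> x; rewrite in_itv/= andbT => x0; rewrite derive1E; have [_ ->] := dF _ x0.
Qed.

Lemma integral_2oneDsqrV : (\int[mu]_x (2 / (1 + x ^+ 2))%:E = (2 * pi)%:E)%E.
Proof.
have c1 : continuous (fun x : R => 2 / (1 + x ^+ 2)).
  by move=> x; apply: cvgM; [exact: cvg_cst|exact: continuous_oneDsqrV].
transitivity ((2 * pi - 4 * atan (0:R))%:E : \bar R); last by rewrite atan0 mulr0 subr0.
apply: (@ge0_integral_fold_FTC (fun x => 2 / (1 + x ^+ 2)) (fun x => 4 * atan x)) => //.
- by move=> x; rewrite divr_ge0// addr_ge0// sqr_ge0.
- by move=> x; apply: cvgM; [exact: cvg_cst|exact: continuous_atan].
- move=> x _; apply: (is_derive_eq (is_derive_mull 4 (is_derive1_atan x))).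
  by rewrite sqrrN -mulrDl; congr (_ * _); ring.
- rewrite (_ : 2 * pi = 4 * (pi / 2)); last by field.
  by apply: cvgM; [exact: cvg_cst|exact: cvgy_atan].
Qed.

(** The summand 1 makes the integrand nonnegative; the case cos d = 0 isolates
its contribution. *)
Lemma integral_expRN_cos (xi d : R) :
  (\int[mu]_x (expR (- `|x|) * (1 + cos (xi * x + d)))%:E =
   (2 + cos d * (2 / (1 + xi ^+ 2)))%:E)%E.
Proof.
have xi0 : 1 + xi ^+ 2 != 0 by rewrite gt_eqF// ltr_pwDl// sqr_ge0.
have cA (a b : R) : continuous (fun x : R => a * x + b).
  by move=> x; apply: cvgD; [exact: mulrl_continuous|exact: cvg_cst].
have cE : continuous (fun x : R => expR (- x)).
  by move=> x; apply: (@continuous_comp _ _ _ -%R expR); [exact: oppr_continuous|exact: continuous_expR].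
have cC a b : continuous (fun x : R => cos (a * x + b)).
  by move=> x; apply: (@continuous_comp _ _ _ (fun x => a * x + b) cos); [exact: cA|exact: continuous_cos].
have cS a b : continuous (fun x : R => sin (a * x + b)).
  by move=> x; apply: (@continuous_comp _ _ _ (fun x => a * x + b) sin); [exact: cA|exact: continuous_sin].
(* exp (- x) B(x) is a primitive of f x + f (- x) on the positive reals. *)
pose B x := -2 + 2 * cos d / (1 + xi ^+ 2) * (xi * sin (xi * x + 0) - cos (xi * x + 0)).
have cB : continuous B.
  move=> x; apply: cvgD; first exact: cvg_cst.
  apply: cvgM; first exact: cvg_cst.
  apply: cvgB; last exact: cC.
  by apply: cvgM; [exact: cvg_cst|exact: cS].
transitivity ((0 - expR (- 0) * B 0)%:E); last first.
  rewrite /B !mulr0 !addr0 oppr0 expR0 sin0 cos0; congr EFin; field; exact: xi0.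
apply: (@ge0_integral_fold_FTC (fun x => expR (- `|x|) * (1 + cos (xi * x + d))) (fun x => expR (- x) * B x)).
- by move=> x; rewrite mulr_ge0 ?expR_ge0// -lerBlDl sub0r cos_geN1.
- move=> x; apply: cvgM.
    by apply: (@continuous_comp _ _ _ (fun x : R => `|x|) (fun x => expR (- x))); [exact: norm_continuous|exact: cE].
  by apply: cvgD; [exact: cvg_cst|exact: cC].
- by move=> x; apply: cvgM; [exact: cE|exact: cB].
- move=> x x0.
  have dE := is_derive_chain (is_derive_expR (- x)) (is_deriveNid x (1 : R)).
  have dS := is_derive_chain (f := fun y => xi * y + 0) (is_derive_sin (xi * x + 0)) (is_derive_affine xi 0 x).
  have dC := is_derive_chain (f := fun y => xi * y + 0) (is_derive_cos (xi * x + 0)) (is_derive_affine xi 0 x).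
  have dB := is_derive_add (is_derive_const x (1 : R) (-2))
    (is_derive_mull (2 * cos d / (1 + xi ^+ 2))
       (is_derive_add (is_derive_mull xi dS) (is_derive_opp dC))).
  apply: (is_derive_eq (is_derive_mul dE dB)).
  rewrite normrN gtr0_norm// /B !addr0 (_ : xi * - x = - (xi * x)) ?mulrN// !cosD sinN cosN; field; exact: xi0.
- apply/cvgrPdist_lt => e e0.
  pose M := 2 + `|2 * cos d / (1 + xi ^+ 2)| * (`|xi| + 1).
  have M0 : 0 < M by rewrite ltr_pwDl// mulr_ge0// addr_ge0.
  have : \forall x \near +oo, expR (- x) < e / M.
    have := @cvgr_expR R => /cvgrPdist_lt/(_ (e / M) (divr_gt0 e0 M0)).
    by apply: filterS => x; rewrite sub0r normrN ger0_norm// expR_ge0.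
  apply: filterS => x hx.
  rewrite sub0r normrN normrM (ger0_norm (expR_ge0 _)).
  apply: (@le_lt_trans _ _ (expR (- x) * M)); last by rewrite -ltr_pdivlMr.
  rewrite ler_wpM2l ?expR_ge0// /B (le_trans (ler_normD _ _))// lerD//.
    by rewrite normrN ger0_norm.
  rewrite normrM ler_wpM2l// (le_trans (ler_normB _ _))// lerD ?cos_max//.
  by rewrite normrM ler_piMr// sin_max.
Qed.

End line_integrals.

(** * The Laplace and Cauchy weights *)

Section continuous_rules.
Variables (R : realType) (T : topologicalType).
Implicit Types (f g : T -> R).

Lemma continuous_mul f g : continuous f -> continuous g -> continuous (fun x => f x * g x).
Proof. by move=> cf cg x; exact: (cvgM (cf x) (cg x)). Qed.

Lemma continuous_add f g : continuous f -> continuous g -> continuous (fun x => f x + g x).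
Proof. by move=> cf cg x; exact: (cvgD (cf x) (cg x)). Qed.

Lemma continuous_const (c : R) : continuous (fun _ : T => c).
Proof. by move=> x; exact: cvg_cst. Qed.

Lemma continuous_chain f (h : R -> R) : continuous f -> continuous h ->
  continuous (fun x => h (f x)).
Proof. by move=> cf ch x; exact: (@continuous_comp _ _ _ f h x (cf x) (ch _)). Qed.

End continuous_rules.

Section kernels.
Variable R : realType.
Local Notation mR := (measurableTypeR R).
Local Notation mu := (@lebesgue_measure R).
Local Notation lam n := (lebesgue_tuple R n).

Definition coord_prod n (h : R -> R) (v : 'rV[R]_n) : R := \prod_(i < n) h (v 0 i).

Definition laplace1 (x : R) : R := expR (- `|x|).

(** The Fourier transform of [laplace1]; its products over the coordinates also
serve as the integrable majorants below. *)
Definition cauchy1 (x : R) : R := 2 / (1 + x ^+ 2).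

Lemma coord_prod_cons n h x (v : 'rV[R]_n) :
  coord_prod h (cons_row x v) = h x * coord_prod h v.
Proof.
rewrite /coord_prod big_ord_recl cons_row0; congr (_ * _).
by apply: eq_bigr => i _; rewrite cons_rowS.
Qed.

Lemma dotprod_cons n (xi : 'rV[R]_n.+1) x (v : 'rV[R]_n) :
  dotprod xi (cons_row x v) = xi 0 ord0 * x + dotprod (behead_row xi) v.
Proof.
rewrite /dotprod big_ord_recl cons_row0; congr (_ + _).
by apply: eq_bigr => i _; rewrite cons_rowS mxE.
Qed.

Lemma coord_prod_behead n h (v : 'rV[R]_n.+1) :
  coord_prod h v = h (v 0 ord0) * coord_prod h (behead_row v).
Proof. by rewrite -{1}(cons_row_behead v) coord_prod_cons. Qed.

Lemma coord_prod_ge0 n h (v : 'rV[R]_n) : (forall x, 0 <= h x) -> 0 <= coord_prod h v.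
Proof. by move=> h0; apply: prodr_ge0. Qed.

Lemma continuous_coord_prod n h : continuous h -> continuous (@coord_prod n h).
Proof.
move=> ch; apply: continuous_big => [|i _ v].
  exact: mul_continuous.
by apply: (@continuous_comp _ _ _ (fun v : 'rV[R]_n => v 0 i) h);
   [exact: coord_continuous|exact: ch].
Qed.

Lemma continuous_dotprod n (xi : 'rV[R]_n) : continuous (dotprod xi).
Proof.
apply: continuous_big => [|i _ v].
  by move=> [x y]; apply: cvgD; [exact: cvg_fst|exact: cvg_snd].
by apply: (@continuous_comp _ _ _ (fun v : 'rV[R]_n => v 0 i) ( *%R (xi 0 i)));
  [exact: coord_continuous|exact: mulrl_continuous].
Qed.

Lemma continuous_cos_dotprod n (xi : 'rV[R]_n) d :
  continuous (fun v => cos (dotprod xi v + d)).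
Proof.
move=> v; apply: (@continuous_comp _ _ _ (dotprod xi) (fun y => cos (y + d))).
  exact: continuous_dotprod.
apply: (@continuous_comp _ _ _ (fun y : R => y + d) cos); last exact: continuous_cos.
by apply: cvgD; [exact: cvg_id|exact: cvg_cst].
Qed.

Lemma continuous_laplace1 : continuous laplace1.
Proof.
move=> x; apply: (@continuous_comp _ _ _ (fun x : R => - `|x|) expR).
  by apply: cvgN; exact: norm_continuous.
exact: continuous_expR.
Qed.

Lemma continuous_cauchy1 : continuous cauchy1.
Proof. by move=> x; apply: cvgM; [exact: cvg_cst|exact: continuous_oneDsqrV]. Qed.

Lemma laplace1_ge0 x : 0 <= laplace1 x. Proof. exact: expR_ge0. Qed.

Lemma oneDsqr_gt0 (x : R) : 0 < 1 + x ^+ 2.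
Proof. by rewrite ltr_pwDl// sqr_ge0. Qed.

Lemma cauchy1_gt0 x : 0 < cauchy1 x.
Proof. by rewrite divr_gt0// oneDsqr_gt0. Qed.

Lemma cauchy1_ge0 x : 0 <= cauchy1 x. Proof. exact/ltW/cauchy1_gt0. Qed.

Lemma cauchy1_le2 x : cauchy1 x <= 2.
Proof. by rewrite ler_pdivrMr ?oneDsqr_gt0// mulrDr mulr1 lerDl mulr_ge0// sqr_ge0. Qed.

Lemma continuous_row_emeasurable n (u : 'rV[R]_n -> R) : continuous u ->
  row_measurable (fun v => (u v)%:E).
Proof. by move=> cu; apply/measurable_EFinP; exact: (continuous_row_measurable cu). Qed.

Lemma ge0_integral_coord_prod n (h : R -> R) (c : R) : (forall x, 0 <= h x) ->
  continuous h -> (\int[mu]_x (h x)%:E = c%:E)%E ->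
  (\int[lam n]_t (coord_prod h (row_of_tuple t))%:E = (c ^+ n)%:E)%E.
Proof.
move=> h0 ch hc; elim: n => [|n IH].
  rewrite (@integral_lebesgue_tuple0 R (fun v => (coord_prod h v)%:E)).
    by rewrite /coord_prod big_ord0.
  exact: (continuous_row_emeasurable (continuous_coord_prod ch)).
have mh : measurable_fun setT h by exact: continuous_measurable_fun.
rewrite (@ge0_integral_lebesgue_tupleS R n (fun v => (coord_prod h v)%:E)); first last.
- by move=> v; rewrite lee_fin coord_prod_ge0.
- exact: (continuous_row_emeasurable (continuous_coord_prod ch)).
transitivity (\int[mu]_x ((h x)%:E * (c ^+ n)%:E))%E.
  apply: eq_integral => x _; rewrite -IH -ge0_integralZl//.
  - by apply: eq_integral => t _; rewrite coord_prod_cons EFinM.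
  - exact: (continuous_row_emeasurable (continuous_coord_prod ch)).
  - by move=> t _; rewrite lee_fin coord_prod_ge0.
  - by rewrite lee_fin h0.
have c0 : 0 <= c by rewrite -lee_fin -hc; apply: integral_ge0 => x _; rewrite lee_fin.
rewrite ge0_integralZr//.
- by rewrite hc -EFinM exprS.
- by apply/measurable_EFinP; exact: mh.
- by move=> x _; rewrite lee_fin.
- by rewrite lee_fin exprn_ge0.
Qed.

Lemma integral_laplace1 : (\int[mu]_x (laplace1 x)%:E = 2%:E)%E.
Proof.
transitivity (\int[mu]_x (expR (- `|x|) * (1 + cos (0 * x + pi / 2)))%:E)%E.
  by apply: eq_integral => x _; rewrite mul0r add0r cos_pihalf addr0 mulr1.
by rewrite integral_expRN_cos cos_pihalf mul0r addr0.
Qed.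

Lemma integral_cauchy n :
  (\int[lam n]_t (coord_prod cauchy1 (row_of_tuple t))%:E = ((2 * pi) ^+ n)%:E)%E.
Proof.
apply: ge0_integral_coord_prod; [exact: cauchy1_ge0|exact: continuous_cauchy1|].
exact: integral_2oneDsqrV.
Qed.

Lemma integral_laplace n :
  (\int[lam n]_t (coord_prod laplace1 (row_of_tuple t))%:E = (2 ^+ n)%:E)%E.
Proof.
apply: ge0_integral_coord_prod; [exact: laplace1_ge0|exact: continuous_laplace1|].
exact: integral_laplace1.
Qed.

(** Induction on the dimension: once the first coordinate x is fixed, the
remaining integral is of the same form, with phase xi_0 x + d. *)
Lemma ge0_integral_laplace_cos n (xi : 'rV[R]_n) (d : R) :
  (\int[lam n]_t (coord_prod laplace1 (row_of_tuple t) *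
       (1 + cos (dotprod xi (row_of_tuple t) + d)))%:E =
   (2 ^+ n + cos d * coord_prod cauchy1 xi)%:E)%E.
Proof.
have cF m (z : 'rV[R]_m) e : row_measurable (fun v =>
    (coord_prod laplace1 v * (1 + cos (dotprod z v + e)))%:E).
  apply: continuous_row_emeasurable.
  apply: continuous_mul; first exact: (continuous_coord_prod continuous_laplace1).
  apply: continuous_add; [exact: continuous_const|exact: continuous_cos_dotprod].
have F0 m (z : 'rV[R]_m) e v : 0 <= coord_prod laplace1 v * (1 + cos (dotprod z v + e)).
  apply: mulr_ge0; first exact/coord_prod_ge0/laplace1_ge0.
  by rewrite -lerBlDl sub0r cos_geN1.
elim: n xi d => [|n IH] xi d.
  rewrite (integral_lebesgue_tuple0 (cF _ xi d)) /coord_prod /dotprod !big_ord0.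
  by rewrite mul1r add0r mulr1 expr0.
rewrite (ge0_integral_lebesgue_tupleS (cF _ xi d)); last by move=> v; rewrite lee_fin F0.
set c := coord_prod cauchy1 (behead_row xi).
have c2 : c <= 2 ^+ n.
  rewrite (_ : 2 ^+ n = \prod_(i < n) 2); last by rewrite prodr_const card_ord.
  by apply: ler_prod => i _; rewrite cauchy1_ge0 cauchy1_le2.
have c0 : 0 <= c by apply/coord_prod_ge0/cauchy1_ge0.
(* Both summands are nonnegative because 0 <= c <= 2 ^+ n. *)
transitivity (\int[mu]_x ((2 ^+ n - c)%:E * (laplace1 x)%:E +
    c%:E * (expR (- `|x|) * (1 + cos (xi 0 ord0 * x + d)))%:E))%E.
  apply: eq_integral => x _.
  transitivity ((laplace1 x)%:E * (2 ^+ n + cos (xi 0 ord0 * x + d) * c)%:E)%E.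
    rewrite -IH -ge0_integralZl//.
    - apply: eq_integral => t _.
      by rewrite coord_prod_cons dotprod_cons -EFinM -mulrA addrAC (addrC _ (dotprod _ _)) addrA.
    - exact: cF.
    - by move=> t _; rewrite lee_fin F0.
    - by rewrite lee_fin laplace1_ge0.
  by rewrite -!EFinM -EFinD; congr EFin; rewrite /laplace1; ring.
rewrite ge0_integralD//; first last.
- apply/measurable_EFinP; apply: continuous_measurable_fun => x.
  apply: cvgM; first exact: cvg_cst.
  apply: cvgM; first exact: continuous_laplace1.
  apply: cvgD; first exact: cvg_cst.
  apply: (@continuous_comp _ _ _ (fun x => xi 0 ord0 * x + d) cos).
    by apply: cvgD; [exact: mulrl_continuous|exact: cvg_cst].
  exact: continuous_cos.
- move=> x _; rewrite -EFinM lee_fin; apply: (mulr_ge0 c0).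
  by apply: mulr_ge0; [exact: expR_ge0|rewrite -lerBlDl sub0r cos_geN1].
- apply/measurable_EFinP; apply: continuous_measurable_fun => x.
  by apply: cvgM; [exact: cvg_cst|exact: continuous_laplace1].
- by move=> x _; rewrite -EFinM lee_fin mulr_ge0 ?laplace1_ge0// subr_ge0.
rewrite ge0_integralZl//; first last.
- by rewrite lee_fin subr_ge0.
- by move=> x _; rewrite lee_fin laplace1_ge0.
- by apply/measurable_EFinP; apply: continuous_measurable_fun; exact: continuous_laplace1.
rewrite ge0_integralZl//; first last.
- apply/measurable_EFinP; apply: continuous_measurable_fun => x.
  apply: cvgM; first exact: continuous_laplace1.
  apply: cvgD; first exact: cvg_cst.
  apply: (@continuous_comp _ _ _ (fun x => xi 0 ord0 * x + d) cos).
    by apply: cvgD; [exact: mulrl_continuous|exact: cvg_cst].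
  exact: continuous_cos.
rewrite integral_laplace1 integral_expRN_cos -!EFinM -EFinD; congr EFin.
rewrite (coord_prod_behead _ xi) -/c -/(cauchy1 _) [2 ^+ n.+1]exprS.
set k := cauchy1 _; set p := 2 ^+ n; ring.
Qed.

End kernels.

(** * Real integrals over rows *)

Section real_row_integral.
Variable R : realType.
Local Notation mR := (measurableTypeR R).
Local Notation mu := (@lebesgue_measure R).
Local Notation lam n := (lebesgue_tuple R n).

Definition rint n (u : 'rV[R]_n -> R) : R := \int[lam n]_t u (row_of_tuple t).

Definition rintegrable n (u : 'rV[R]_n -> R) :=
  (lam n).-integrable setT (fun t => (u (row_of_tuple t))%:E).

Lemma eq_rint n (u w : 'rV[R]_n -> R) : u =1 w -> rint u = rint w.
Proof. by move=> uw; congr rint; apply/funext. Qed.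

Lemma rintegrable_measurable n (u : 'rV[R]_n -> R) : rintegrable u -> row_measurable u.
Proof. by move=> /integrableP[/measurable_EFinP]. Qed.

Lemma rintegrable_le n (u w : 'rV[R]_n -> R) : row_measurable u ->
  (forall v, `|u v| <= `|w v|) -> rintegrable w -> rintegrable u.
Proof.
move=> mu0 uw iw; apply: (le_integrable measurableT _ _ iw).
  exact/measurable_EFinP.
by move=> t _ /=; rewrite lee_fin.
Qed.

Lemma rintZ n (u : 'rV[R]_n -> R) (c : R) : rintegrable u ->
  rint (fun v => c * u v) = c * rint u.
Proof. by move=> iu; exact: (RintegralZl _ measurableT iu). Qed.

Lemma rintegrableZ n (u : 'rV[R]_n -> R) (c : R) : rintegrable u ->
  rintegrable (fun v => c * u v).
Proof. by move=> iu; exact: (integrableZl measurableT c iu). Qed.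

Lemma rintD n (u w : 'rV[R]_n -> R) : rintegrable u -> rintegrable w ->
  rint (fun v => u v + w v) = rint u + rint w.
Proof. by move=> iu iw; exact: (RintegralD measurableT iu iw). Qed.

Lemma rintegrableD n (u w : 'rV[R]_n -> R) : rintegrable u -> rintegrable w ->
  rintegrable (fun v => u v + w v).
Proof. by move=> iu iw; exact: (integrableD measurableT iu iw). Qed.

Lemma rintB n (u w : 'rV[R]_n -> R) : rintegrable u -> rintegrable w ->
  rint (fun v => u v - w v) = rint u - rint w.
Proof. by move=> iu iw; exact: (RintegralB measurableT iu iw). Qed.

Lemma rintegrableB n (u w : 'rV[R]_n -> R) : rintegrable u -> rintegrable w ->
  rintegrable (fun v => u v - w v).
Proof. by move=> iu iw; exact: (integrableB measurableT iu iw). Qed.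

Lemma rint_affine n (u : 'rV[R]_n -> R) (a : R) b : a != 0 -> rintegrable u ->
  rint (fun v => u (a *: v + b)) = `|a| ^- n * rint u.
Proof. by move=> a0 iu; exact: Rintegral_row_affine. Qed.

Lemma rintegrable_affine n (u : 'rV[R]_n -> R) (a : R) b : a != 0 -> rintegrable u ->
  rintegrable (fun v => u (a *: v + b)).
Proof. by move=> a0 iu; exact: integrable_row_affine. Qed.

Lemma le_rint_norm n (u w : 'rV[R]_n -> R) : row_measurable u ->
  (forall v, `|u v| <= w v) -> rintegrable w -> `|rint u| <= rint w.
Proof.
move=> mu0 uw iw.
have iu : rintegrable u.
  apply: (rintegrable_le mu0 _ iw) => v; rewrite (ger0_norm (le_trans _ (uw v)))//.
rewrite (le_trans (le_normr_Rintegral measurableT iu))//.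
by apply: (le_Rintegral measurableT (integrable_abse iu) iw) => t _; exact: uw.
Qed.

Lemma rint_dominated_cvg n (u_ : nat -> 'rV[R]_n -> R) (u w : 'rV[R]_n -> R) :
  (forall k, row_measurable (u_ k)) -> row_measurable u ->
  (forall v, u_ k v @[k --> \oo] --> u v) -> rintegrable w ->
  (forall k v, `|u_ k v| <= w v) ->
  rint (u_ k) @[k --> \oo] --> rint u.
Proof.
move=> mu_ mu0 cu iw uw.
have cuE v : (u_ k v)%:E @[k --> \oo] --> (u v)%:E.
  by apply: cvg_EFin; [exact: nearW|exact: cu].
have [iu _ h] := @dominated_convergence _ _ R (lam n) setT measurableT
  (fun k t => (u_ k (row_of_tuple t))%:E) (fun t => (u (row_of_tuple t))%:E)
  (fun t => (w (row_of_tuple t))%:E)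
  (fun k => (measurable_EFinP _ _).2 (mu_ k)) ((measurable_EFinP _ _).2 mu0)
  (aeW _ (fun t _ => cuE (row_of_tuple t))) iw
  (aeW _ (fun t k _ => uw k (row_of_tuple t))).
apply: fine_cvg; rewrite /rint /Rintegral fineK//.
exact: (integrable_fin_num measurableT iu).
Qed.

(** A majorant which splits as a product of two integrable functions makes the
integrand integrable for the product measure. *)
Lemma rint_fubini m n (f : 'rV[R]_m -> 'rV[R]_n -> R) (g : 'rV[R]_m -> R) (h : 'rV[R]_n -> R) :
  measurable_fun setT (fun p : m.-tuple mR * n.-tuple mR =>
     f (row_of_tuple p.1) (row_of_tuple p.2)) ->
  rintegrable g -> rintegrable h -> (forall x y, `|f x y| <= g x * h y) ->
  (forall x, 0 <= g x) -> (forall y, 0 <= h y) ->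
  [/\ row_measurable (fun x => rint (f x)) &
      rint (fun x => rint (f x)) = rint (fun y => rint (f ^~ y))].
Proof.
move=> mf ig ih fgh g0 h0.
pose F (p : m.-tuple mR * n.-tuple mR) := (f (row_of_tuple p.1) (row_of_tuple p.2))%:E.
have mF : measurable_fun setT F by exact/measurable_EFinP.
have hfin : (\int[lam n]_y (h (row_of_tuple y))%:E = (rint h)%:E)%E.
  by rewrite /rint /Rintegral fineK//; exact: (integrable_fin_num measurableT ih).
have gfin : (\int[lam m]_y (g (row_of_tuple y))%:E = (rint g)%:E)%E.
  by rewrite /rint /Rintegral fineK//; exact: (integrable_fin_num measurableT ig).
have mh := rintegrable_measurable ih; have mg := rintegrable_measurable ig.
have rh0 : 0 <= rint h by apply: Rintegral_ge0 => t _; exact: h0.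
have iF : (lam m \x lam n)%E.-integrable setT F.
  apply/integrable12ltyP => //.
  apply: (@le_lt_trans _ _ (\int[lam m]_x ((g (row_of_tuple x))%:E * (rint h)%:E))%E).
    apply: ge0_le_integral => //.
    - by move=> x _; apply: integral_ge0.
    - apply: (@measurable_fun_fubini_tonelli_F _ _ _ _ R (lam n) (fun p => `|F p|%E)) => //.
      exact: measurableT_comp.
    - by apply: emeasurable_funM => //; exact/measurable_EFinP.
    - move=> x _; rewrite -hfin -ge0_integralZl//.
      + apply: ge0_le_integral => //.
        * apply: measurableT_comp => //; apply/measurable_EFinP.
          exact: (measurableT_comp mf (@pair1_measurable _ _ _ _ x)).
        * by apply: emeasurable_funM => //; exact/measurable_EFinP.
        * by move=> y _; rewrite /F /= lee_fin.
      + exact/measurable_EFinP.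
      + by move=> y _; rewrite lee_fin.
      + by rewrite lee_fin.
  rewrite ge0_integralZr//.
  - by rewrite gfin -EFinM ltry.
  - exact/measurable_EFinP.
  - by move=> x _; rewrite lee_fin.
have mfin d (T : measurableType d) (G : T -> \bar R) :
    measurable_fun setT G -> measurable_fun setT (fine \o G).
  by move=> mG; apply: measurableT_comp mG; exact: fine_measurable.
split; first exact: (mfin _ _ _ (measurable_fubini_F iF)).
have fin1 x : (\int[lam n]_y F (x, y) = (rint (f (row_of_tuple x)))%:E)%E.
  rewrite /rint /Rintegral fineK//; apply: (integrable_fin_num measurableT).
  apply: (@rintegrable_le n (f (row_of_tuple x)) (fun y => g (row_of_tuple x) * h y)).
  - exact: (measurableT_comp mf (@pair1_measurable _ _ _ _ x)).
  - by move=> y; rewrite [leRHS]ger0_norm// mulr_ge0.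
  - exact: rintegrableZ.
have fin2 y : (\int[lam m]_x F (x, y) = (rint (f ^~ (row_of_tuple y)))%:E)%E.
  rewrite /rint /Rintegral fineK//; apply: (integrable_fin_num measurableT).
  apply: (@rintegrable_le m (f ^~ (row_of_tuple y)) (fun x => h (row_of_tuple y) * g x)).
  - exact: (measurableT_comp mf (@pair2_measurable _ _ _ _ y)).
  - by move=> x; rewrite [leRHS]ger0_norm ?mulr_ge0// mulrC.
  - exact: rintegrableZ.
have := Fubini iF.
under eq_integral do rewrite fin1.
under [X in _ = X -> _]eq_integral do rewrite fin2.
by move=> FE; exact: (congr1 fine FE).
Qed.

End real_row_integral.

(** * Inversion of the cosine transform *)

Section inversion.
Variable R : realType.
Local Notation mR := (measurableTypeR R).

(** The phase d makes one real transform account for both parts of the Fourier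
transform, since cos (t + pi / 2) = - sin t. *)
Definition cosine_transform n (u : 'rV[R]_n -> R) (d : R) (xi : 'rV[R]_n) : R :=
  rint (fun v => cos (dotprod xi v + d) * u v).

Local Notation cauchy := (coord_prod (@cauchy1 R)).
Local Notation laplace := (coord_prod (@laplace1 R)).

Lemma dotprodC n (x y : 'rV[R]_n) : dotprod x y = dotprod y x.
Proof. by apply: eq_bigr => i _; rewrite mulrC. Qed.

Lemma dotprodDr n (x y z : 'rV[R]_n) : dotprod x (y + z) = dotprod x y + dotprod x z.
Proof. by rewrite -big_split; apply: eq_bigr => i _; rewrite mxE mulrDr. Qed.

Lemma dotprodZr n (a : R) (x y : 'rV[R]_n) : dotprod x (a *: y) = a * dotprod x y.
Proof. by rewrite [RHS]mulr_sumr; apply: eq_bigr => i _; rewrite mxE mulrCA. Qed.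

Lemma dotprodZl n (a : R) (x y : 'rV[R]_n) : dotprod (a *: x) y = a * dotprod x y.
Proof. by rewrite dotprodC dotprodZr dotprodC. Qed.

Lemma dotprodNr n (x y : 'rV[R]_n) : dotprod x (- y) = - dotprod x y.
Proof. by rewrite -scaleN1r dotprodZr mulN1r. Qed.

Lemma dotprodDl n (x y z : 'rV[R]_n) : dotprod (x + y) z = dotprod x z + dotprod y z.
Proof. by rewrite dotprodC dotprodDr !(dotprodC z). Qed.

Lemma dotprodNl n (x y : 'rV[R]_n) : dotprod (- x) y = - dotprod x y.
Proof. by rewrite dotprodC dotprodNr dotprodC. Qed.

Lemma cauchy_ge0 n (v : 'rV[R]_n) : 0 <= cauchy v.
Proof. exact/coord_prod_ge0/cauchy1_ge0. Qed.

Lemma laplace_ge0 n (v : 'rV[R]_n) : 0 <= laplace v.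
Proof. exact/coord_prod_ge0/laplace1_ge0. Qed.

Lemma laplace_le1 n (v : 'rV[R]_n) : laplace v <= 1.
Proof.
apply: prodr_ile1 => i _; rewrite laplace1_ge0 /=.
by rewrite /laplace1 expR_le1 oppr_le0.
Qed.

Lemma cauchy_le n (v : 'rV[R]_n) : cauchy v <= 2 ^+ n.
Proof.
rewrite (_ : 2 ^+ n = \prod_(i < n) 2); last by rewrite prodr_const card_ord.
by apply: ler_prod => i _; rewrite cauchy1_ge0 cauchy1_le2.
Qed.

Lemma continuous_cauchy n : continuous (@coord_prod R n (@cauchy1 R)).
Proof. exact: (continuous_coord_prod (@continuous_cauchy1 R)). Qed.

Lemma continuous_laplace n : continuous (@coord_prod R n (@laplace1 R)).
Proof. exact: (continuous_coord_prod (@continuous_laplace1 R)). Qed.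

Lemma ge0_rintegrable n (u : 'rV[R]_n -> R) (c : R) : row_measurable u ->
  (forall v, 0 <= u v) ->
  (\int[lebesgue_tuple R n]_t (u (row_of_tuple t))%:E = c%:E)%E ->
  rintegrable u /\ rint u = c.
Proof.
move=> mu0 u0 uc; split; last by rewrite /rint /Rintegral uc.
apply/integrableP; split; first exact/measurable_EFinP.
under eq_integral do rewrite gee0_abs ?lee_fin//.
by rewrite uc ltry.
Qed.

Lemma rintegrable_cauchy n : rintegrable (@coord_prod R n (@cauchy1 R)).
Proof.
by have [] := ge0_rintegrable (continuous_row_measurable (@continuous_cauchy n))
  (@cauchy_ge0 n) (integral_cauchy R n).
Qed.

Lemma rint_cauchy n : rint (@coord_prod R n (@cauchy1 R)) = (2 * pi) ^+ n.
Proof.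
by have [] := ge0_rintegrable (continuous_row_measurable (@continuous_cauchy n))
  (@cauchy_ge0 n) (integral_cauchy R n).
Qed.

Lemma rintegrable_laplace n : rintegrable (@coord_prod R n (@laplace1 R)).
Proof.
by have [] := ge0_rintegrable (continuous_row_measurable (@continuous_laplace n))
  (@laplace_ge0 n) (integral_laplace R n).
Qed.

Lemma rintegrable_laplace_cos n (xi : 'rV[R]_n) d :
  rintegrable (fun v => laplace v * cos (dotprod xi v + d)).
Proof.
apply: (rintegrable_le _ _ (@rintegrable_laplace n)) => [|v].
  apply: continuous_row_measurable; apply: continuous_mul; first exact: continuous_laplace.
  exact: continuous_cos_dotprod.
by rewrite normrM ler_piMr// cos_max.
Qed.

(** The Fourier transform of the Laplace weight is the Cauchy weight. *)
Lemma rint_laplace_cos n (xi : 'rV[R]_n) d :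
  rint (fun v => laplace v * cos (dotprod xi v + d)) = cos d * cauchy xi.
Proof.
have h := ge0_integral_laplace_cos xi d.
have [|v|_ h1] := ge0_rintegrable (u := fun v => laplace v * (1 + cos (dotprod xi v + d))) _ _ h.
- apply: continuous_row_measurable; apply: continuous_mul; first exact: continuous_laplace.
  by apply: continuous_add; [exact: continuous_const|exact: continuous_cos_dotprod].
- by apply: mulr_ge0; [exact: laplace_ge0|rewrite -lerBlDl sub0r cos_geN1].
have := rintD (@rintegrable_laplace n) (rintegrable_laplace_cos xi d).
have [_ ->] := ge0_rintegrable (continuous_row_measurable (@continuous_laplace n))
  (@laplace_ge0 n) (integral_laplace R n).
rewrite (@eq_rint R n _ (fun v => laplace v * (1 + cos (dotprod xi v + d)))); last first.
  by move=> v; rewrite mulrDr mulr1.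
by rewrite h1 => /addrI.
Qed.

Lemma rint_laplace_cos_scaled n (e : R) (y : 'rV[R]_n) d : 0 < e ->
  rint (fun xi => laplace (e *: xi) * cos (dotprod xi y + d)) =
  e ^- n * (cos d * cauchy (e^-1 *: y)).
Proof.
move=> e0; rewrite -rint_laplace_cos -[e in e ^- n]gtr0_norm//.
rewrite -(@rint_affine R n _ e 0) ?gt_eqF//; last exact: rintegrable_laplace_cos.
apply: eq_rint => v; rewrite addr0 dotprodZl dotprodZr mulrA mulVf ?gt_eqF// mul1r.
by rewrite dotprodC.
Qed.

Lemma measurable_dotprod n :
  measurable_fun setT (fun p : n.-tuple mR * n.-tuple mR =>
    dotprod (row_of_tuple p.1) (row_of_tuple p.2)).
Proof.
rewrite /dotprod; apply: measurable_sum => i.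
apply: measurable_funM.
  exact: (measurableT_comp (@row_measurable_coord R n i) measurable_fst).
exact: (measurableT_comp (@row_measurable_coord R n i) measurable_snd).
Qed.

Lemma measurable_row_fst n (u : 'rV[R]_n -> R) : row_measurable u ->
  measurable_fun setT (fun p : n.-tuple mR * n.-tuple mR => u (row_of_tuple p.1)).
Proof. by move=> mu0; exact: (measurableT_comp mu0 measurable_fst). Qed.

Lemma measurable_row_snd n (u : 'rV[R]_n -> R) : row_measurable u ->
  measurable_fun setT (fun p : n.-tuple mR * n.-tuple mR => u (row_of_tuple p.2)).
Proof. by move=> mu0; exact: (measurableT_comp mu0 measurable_snd). Qed.

Lemma measurable_cos_dotprod n (d : R) :
  measurable_fun setT (fun p : n.-tuple mR * n.-tuple mR =>
    cos (dotprod (row_of_tuple p.1) (row_of_tuple p.2) + d)).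
Proof.
apply: (@measurableT_comp _ _ _ _ _ _ (fun y : R => cos (y + d))).
  apply: continuous_measurable_fun; apply: continuous_chain; last exact: continuous_cos.
  by move=> x; apply: cvgD; [exact: cvg_id|exact: cvg_cst].
exact: measurable_dotprod.
Qed.

Lemma rintegrable_cos n (u : 'rV[R]_n -> R) (xi : 'rV[R]_n) d : rintegrable u ->
  rintegrable (fun v => cos (dotprod xi v + d) * u v).
Proof.
move=> iu; apply: (rintegrable_le _ _ iu) => [|v].
  apply: measurable_funM; last exact: rintegrable_measurable.
  exact: (continuous_row_measurable (@continuous_cos_dotprod R n xi d)).
by rewrite normrM ler_piMl// cos_max.
Qed.

(** Multiplied by the Cauchy weight in xi, the kernel becomes integrable in both
variables, and Fubini's theorem gives the measurability; the weight is then
divided out. *)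
Lemma measurable_cosine_transform n (u : 'rV[R]_n -> R) d : rintegrable u ->
  row_measurable (cosine_transform u d).
Proof.
move=> iu; have mu0 := rintegrable_measurable iu.
pose f (xi v : 'rV[R]_n) := cauchy xi * (cos (dotprod xi v + d) * u v).
have iN : rintegrable (fun v => `|u v|) by exact: integrable_norm.
have mj : measurable_fun setT (fun p : n.-tuple mR * n.-tuple mR =>
    f (row_of_tuple p.1) (row_of_tuple p.2)).
  apply: measurable_funM; first exact: (measurable_row_fst (continuous_row_measurable (@continuous_cauchy n))).
  by apply: measurable_funM; [exact: measurable_cos_dotprod|exact: measurable_row_snd].
have fle x y : `|f x y| <= cauchy x * `|u y|.
  rewrite /f !normrM ger0_norm ?cauchy_ge0// ler_wpM2l ?cauchy_ge0//.
  by rewrite ler_piMl// cos_max.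
have [mf _] := rint_fubini mj (@rintegrable_cauchy n) iN fle (@cauchy_ge0 n) (fun=> normr_ge0 _).
have cinv : row_measurable (fun xi : 'rV[R]_n => (cauchy xi)^-1).
  apply: continuous_row_measurable => v.
  have v0 : cauchy v != 0 by apply: lt0r_neq0; apply: prodr_gt0 => i _; exact: cauchy1_gt0.
  exact: (cvgV v0 (@continuous_cauchy n v)).
have := measurable_funM cinv mf.
rewrite /row_measurable; congr measurable_fun; apply/funext => t /=.
rewrite /f (rintZ _ (rintegrable_cos _ _ iu)) mulKf//.
by apply: lt0r_neq0; apply: prodr_gt0 => i _; exact: cauchy1_gt0.
Qed.

End inversion.

Section inversion_theorem.
Variable R : realType.
Local Notation mR := (measurableTypeR R).
Local Notation cauchy := (coord_prod (@cauchy1 R)).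
Local Notation laplace := (coord_prod (@laplace1 R)).

Lemma rintegrable_cauchy_le n (u : 'rV[R]_n -> R) (C : R) : row_measurable u ->
  (forall v, `|u v| <= C * cauchy v) -> rintegrable u.
Proof.
move=> mu0 uC; apply: (rintegrable_le mu0 _ (rintegrableZ C (@rintegrable_cauchy R n))).
by move=> v; rewrite (le_trans (uC v))// ler_norm.
Qed.

Lemma cvg_harmonic_row n (v y : 'rV[R]_n) :
  (k.+1%:R^-1 : R) *: v + y @[k --> \oo] --> y.
Proof.
have h : ((k.+1%:R^-1 : R) *: v) @[k --> \oo] --> (0 : R) *: v.
  by apply: cvgZr_tmp; exact: cvg_harmonic.
have hD := cvgD h (cvg_cst y); rewrite scale0r add0r in hD; exact: hD.
Qed.

(** The rescaled Cauchy weights form an approximate identity, of total mass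
(2 pi)^n. *)
Lemma rint_cauchy_approx n (u : 'rV[R]_n -> R) (C : R) (y : 'rV[R]_n) :
  continuous u -> (forall v, `|u v| <= C) ->
  rint (fun z => u (k.+1%:R^-1 *: z + y) * cauchy z) @[k --> \oo] -->
  (2 * pi) ^+ n * u y.
Proof.
move=> cu uC; rewrite mulrC -rint_cauchy -rintZ; last exact: rintegrable_cauchy.
apply: (rint_dominated_cvg (w := fun v => C * cauchy v)).
- move=> k; apply: measurable_funM; last exact: (continuous_row_measurable (@continuous_cauchy R n)).
  exact: row_measurable_affine (continuous_row_measurable cu).
- apply: measurable_funM => //; exact: (continuous_row_measurable (@continuous_cauchy R n)).
- move=> v.
  have h : u (k.+1%:R^-1 *: v + y) @[k --> \oo] --> u y.
    have cuy : u x @[x --> y] --> u y by exact: cu.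
    exact: (cvg_comp _ _ (@cvg_harmonic_row n v y) cuy).
  exact: (cvgM h (cvg_cst (cauchy v))).
- exact/rintegrableZ/rintegrable_cauchy.
- by move=> k v; rewrite normrM (ger0_norm (cauchy_ge0 _)) ler_wpM2r ?cauchy_ge0.
Qed.

(** The product of two cosines is what makes both u eta and u (- eta) appear in
the inversion formula. *)
Lemma cosM_dotprod n (eta xi x : 'rV[R]_n) d e :
  cos (dotprod eta xi + e) * cos (dotprod xi x + d) =
  2^-1 * cos (dotprod xi (x + eta) + (d + e)) +
  2^-1 * cos (dotprod xi (x - eta) + (d - e)).
Proof.
rewrite !dotprodDr dotprodNr (dotprodC eta).
set a := dotprod xi eta; set b := dotprod xi x.
rewrite (_ : b + a + (d + e) = (b + d) + (a + e)); last by ring.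
rewrite (_ : b - a + (d - e) = (b + d) - (a + e)); last by ring.
by move: (b + d) (a + e) => p q; rewrite cosD cosB; field.
Qed.

Lemma rint_laplace_cosM n (eps : R) (eta x : 'rV[R]_n) d e : 0 < eps ->
  rint (fun xi => laplace (eps *: xi) * (cos (dotprod eta xi + e) * cos (dotprod xi x + d))) =
  2^-1 * (eps ^- n * (cos (d + e) * cauchy (eps^-1 *: (x + eta)))) +
  2^-1 * (eps ^- n * (cos (d - e) * cauchy (eps^-1 *: (x - eta)))).
Proof.
move=> e0.
have iL y c : rintegrable (fun xi => laplace (eps *: xi) * cos (dotprod xi y + c)).
  have := rintegrable_affine 0 (lt0r_neq0 e0) (rintegrable_laplace_cos (eps^-1 *: y) c).
  rewrite /rintegrable; congr (_.-integrable _ _); apply/funext => t.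
  rewrite addr0 dotprodZl dotprodZr mulrA mulVf ?gt_eqF// mul1r.
  by rewrite (dotprodC y).
rewrite -!rint_laplace_cos_scaled// -!rintZ// -rintD; try exact: rintegrableZ.
by apply: eq_rint => xi; rewrite cosM_dotprod; ring.
Qed.

Lemma rint_mul_cauchy_scaled n (u : 'rV[R]_n -> R) (C eps : R) (y : 'rV[R]_n) :
  continuous u -> (forall v, `|u v| <= C) -> 0 < eps ->
  let w := fun x => u x * (eps ^- n * cauchy (eps^-1 *: (x + y))) in
  rintegrable w /\ rint w = rint (fun z => u (eps *: z - y) * cauchy z).
Proof.
move=> cu uC e0 w.
have en0 : eps != 0 by exact: lt0r_neq0.
have wE z : w (eps *: z - y) = eps ^- n * (u (eps *: z - y) * cauchy z).
  by rewrite /w subrK scalerA mulVf// scale1r mulrCA.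
have iz : rintegrable (fun z => u (eps *: z - y) * cauchy z).
  apply: (@rintegrable_cauchy_le n _ C).
    apply: measurable_funM; last exact: (continuous_row_measurable (@continuous_cauchy R n)).
    exact: row_measurable_affine (continuous_row_measurable cu).
  by move=> v; rewrite normrM (ger0_norm (cauchy_ge0 _)) ler_wpM2r ?cauchy_ge0.
have iw : rintegrable w.
  have := rintegrable_affine (eps^-1 *: y) (invr_neq0 en0) (rintegrableZ (eps ^- n) iz).
  rewrite /rintegrable; congr (_.-integrable _ _); apply/funext => t.
  by rewrite -wE scalerDr !scalerA divff// !scale1r addrK.
split=> //.
have := rint_affine (- y) en0 iw.
rewrite (eq_rint wE) rintZ// gtr0_norm// => /mulfI h; apply/esym/h.
by rewrite invr_neq0// expf_neq0.
Qed.

(** The outer integral is regularised by the factor laplace (eps xi).  It then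
converges to the left-hand side because the transform is dominated by the Cauchy
weight; and, by Fubini's theorem, it is an integral of u against rescaled Cauchy
weights centred at eta and - eta, which converges to the right-hand side. *)
Theorem cosine_inversion n (u : 'rV[R]_n -> R) (C C' : R) : continuous u ->
  (forall v, `|u v| <= C * cauchy v) ->
  (forall d xi, `|cosine_transform u d xi| <= C' * cauchy xi) ->
  forall eta d e,
  rint (fun xi => cos (dotprod eta xi + e) * cosine_transform u d xi) =
  (2 * pi) ^+ n / 2 * (cos (d + e) * u (- eta) + cos (d - e) * u eta).
Proof.
move=> cu uC uC' eta d e.
have mu0 := continuous_row_measurable cu.
have iu := rintegrable_cauchy_le mu0 uC.
have C0 : 0 <= C.
  have := le_trans (normr_ge0 _) (uC 0); rewrite pmulr_lge0//.
  by apply: prodr_gt0 => i _; exact: cauchy1_gt0.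
have ub v : `|u v| <= C * 2 ^+ n.
  by rewrite (le_trans (uC v))// ler_wpM2l// cauchy_le.
have mct := measurable_cosine_transform d iu.
have ict : rintegrable (fun xi : 'rV[R]_n => C' * cauchy xi) by apply: rintegrableZ; exact: rintegrable_cauchy.
pose eps (k : nat) : R := k.+1%:R^-1.
have eps0 k : 0 < eps k by rewrite invr_gt0.
pose I k := rint (fun xi => laplace (eps k *: xi) *
  (cos (dotprod eta xi + e) * cosine_transform u d xi)).
have mcos : row_measurable (fun xi => cos (dotprod eta xi + e)).
  exact: (continuous_row_measurable (@continuous_cos_dotprod R n eta e)).
have cvg1 : I k @[k --> \oo] -->
    rint (fun xi => cos (dotprod eta xi + e) * cosine_transform u d xi).
  apply: (rint_dominated_cvg (w := fun xi => C' * cauchy xi)) => //.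
  - move=> k; apply: measurable_funM.
      have := row_measurable_affine (eps k) 0 (continuous_row_measurable (@continuous_laplace R n)).
      by under eq_fun do rewrite addr0.
    exact: measurable_funM.
  - exact: measurable_funM.
  - move=> v.
    have L0 : laplace (0 : 'rV[R]_n) = 1.
      by apply: big1 => i _; rewrite mxE /laplace1 normr0 oppr0 expR0.
    have h : laplace (eps k *: v) @[k --> \oo] --> (1 : R).
      have cl : laplace x @[x --> (0 : 'rV[R]_n)] --> (1 : R).
        by rewrite -L0; exact: continuous_laplace.
      have := cvg_comp _ _ (@cvg_harmonic_row n v 0) cl.
      by apply: cvg_trans; apply: near_eq_cvg; apply: nearW => k /=; rewrite addr0.
    have hM := cvgM h (cvg_cst (cos (dotprod eta v + e) * cosine_transform u d v)).
    rewrite mul1r in hM; exact: hM.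
  - move=> k v; rewrite normrM (ger0_norm (laplace_ge0 _)) normrM.
    apply: le_trans (uC' d v).
    by rewrite mulrA ler_piMl// mulr_ile1 ?laplace_ge0 ?laplace_le1 ?cos_max.
have IE k : I k = 2^-1 * (cos (d + e) * rint (fun z => u (eps k *: z - eta) * cauchy z))
    + 2^-1 * (cos (d - e) * rint (fun z => u (eps k *: z + eta) * cauchy z)).
  pose f (xi x : 'rV[R]_n) := laplace (eps k *: xi) *
    (cos (dotprod eta xi + e) * (cos (dotprod xi x + d) * u x)).
  have iL : rintegrable (fun xi : 'rV[R]_n => laplace (eps k *: xi)).
    have := rintegrable_affine 0 (lt0r_neq0 (eps0 k)) (@rintegrable_laplace R n).
    by rewrite /rintegrable; under eq_fun do rewrite addr0.
  have iN : rintegrable (fun v => `|u v|) by exact: integrable_norm.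
  have mj : measurable_fun setT (fun p : n.-tuple mR * n.-tuple mR =>
      f (row_of_tuple p.1) (row_of_tuple p.2)).
    apply: measurable_funM.
      exact: (measurable_row_fst (rintegrable_measurable iL)).
    apply: measurable_funM; first exact: (measurable_row_fst mcos).
    by apply: measurable_funM; [exact: measurable_cos_dotprod|exact: measurable_row_snd].
  have fle x y : `|f x y| <= laplace (eps k *: x) * `|u y|.
    rewrite /f !normrM (ger0_norm (laplace_ge0 _)) ler_wpM2l ?laplace_ge0//.
    by rewrite mulrA ler_piMl// mulr_ile1// cos_max.
 have [_ FE] := rint_fubini mj iL iN fle (fun=> laplace_ge0 _) (fun=> normr_ge0 _).
  transitivity (rint (fun xi => rint (f xi))).
    apply: eq_rint => xi.
    rewrite -rintZ; last exact: rintegrable_cos.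
    rewrite -rintZ; last exact/rintegrableZ/rintegrable_cos.
    by apply: eq_rint => v.
  rewrite FE.
 have [iw1 w1] := rint_mul_cauchy_scaled eta cu ub (eps0 k).
  have [] := rint_mul_cauchy_scaled (- eta) cu ub (eps0 k).
  rewrite opprK => iw2 w2.
  set W1 := fun x => _ in iw1 w1; set W2 := fun x => _ in iw2 w2.
  have i1 := rintegrableZ (cos (d + e)) iw1.
  have i2 := rintegrableZ (cos (d - e)) iw2.
  rewrite -[X in _ * (_ * X) + _]w1 -[X in _ + _ * (_ * X)]w2.
  rewrite -(rintZ (cos (d + e)) iw1) -(rintZ (cos (d - e)) iw2).
  apply: (etrans _ (congr2 +%R (rintZ 2^-1 i1) (rintZ 2^-1 i2))).
  rewrite -(rintD (rintegrableZ _ i1) (rintegrableZ _ i2)).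
  apply: eq_rint => x.
  transitivity (u x * rint (fun xi => laplace (eps k *: xi) *
      (cos (dotprod eta xi + e) * cos (dotprod xi x + d)))).
    rewrite -rintZ.
      by apply: eq_rint => xi; rewrite /f; ring.
    apply: (rintegrable_le _ _ iL).
      apply: measurable_funM; first exact: (rintegrable_measurable iL).
      apply: measurable_funM; first exact: mcos.
      rewrite (_ : (fun t => _) = (fun v => cos (dotprod x v + d)) \o @row_of_tuple R n).
        exact: (continuous_row_measurable (@continuous_cos_dotprod R n x d)).
      by apply/funext => t; rewrite /= dotprodC.
    move=> v; rewrite normrM; apply: ler_piMr; first exact: normr_ge0.
    rewrite normrM; exact: (mulr_ile1 (normr_ge0 _) (normr_ge0 _) (cos_max _) (cos_max _)).
  rewrite (rint_laplace_cosM _ _ _ _ (eps0 k)) /W1 /W2. ring.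
have cvg2 : I k @[k --> \oo] -->
   2^-1 * (cos (d + e) * ((2 * pi) ^+ n * u (- eta))) +
   2^-1 * (cos (d - e) * ((2 * pi) ^+ n * u eta)).
  have h1 : rint (fun z => u (eps k *: z - eta) * cauchy z) @[k --> \oo] -->
      (2 * pi) ^+ n * u (- eta) by exact: rint_cauchy_approx cu ub.
  have h2 : rint (fun z => u (eps k *: z + eta) * cauchy z) @[k --> \oo] -->
      (2 * pi) ^+ n * u eta by exact: rint_cauchy_approx cu ub.
  rewrite (_ : I = fun k => 2^-1 * (cos (d + e) * rint (fun z => u (eps k *: z - eta) * cauchy z))
    + 2^-1 * (cos (d - e) * rint (fun z => u (eps k *: z + eta) * cauchy z))); last exact/funext.
  exact: (cvgD (cvgM (cvg_cst _) (cvgM (cvg_cst _) h1)) (cvgM (cvg_cst _) (cvgM (cvg_cst _) h2))).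
rewrite -(cvg_lim _ cvg1)// (cvg_lim _ cvg2)//.
by field.
Qed.

End inversion_theorem.

(** * Partial derivatives *)

Section partials.
Variables (R : realType) (n : nat).
Implicit Types (u w : 'rV[R]_n -> R) (x y : 'rV[R]_n) (i j : 'I_n).

Local Notation e_ i := (delta_mx 0 i : 'rV[R]_n).

Definition derivable_everywhere u := forall x i, derivable u x (e_ i).

Lemma is_derive_partial u x i : derivable u x (e_ i) ->
  is_derive x (e_ i) u (partial i u x).
Proof. exact: derivableP. Qed.

Lemma is_derive_along u y v (t : R) (df : R) : is_derive (t *: v + y) v u df ->
  is_derive t 1 (fun s : R => u (s *: v + y)) df.
Proof.
move=> /is_derive_lineP h; apply/is_derive_lineP.
rewrite (_ : (fun s : R => _) = (fun s : R => u (s *: v + (t *: v + y)))) //.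
by apply/funext => s; rewrite [s *: 1]mulr1 scalerDl addrA.
Qed.

Lemma partial_MVT u y i (h : R) : derivable_everywhere u ->
  exists2 c : R, `|c| <= `|h| &
    u (h *: e_ i + y) - u y = h * partial i u (c *: e_ i + y).
Proof.
move=> du; pose f (s : R) := u (s *: e_ i + y).
have df (s : R) : is_derive s 1 f (partial i u (s *: e_ i + y)).
  by apply: is_derive_along; exact: is_derive_partial.
have cf : continuous f.
  by move=> s; apply/differentiable_continuous/derivable1_diffP; have [] := df s.
have f0 : f 0 = u y by rewrite /f scale0r add0r.
have [h0|h0] := leP 0 h.
- have [c /[!in_itv]/= /andP[c0 ch] E] := MVT_segment h0 (fun s _ => df s) (continuous_subspaceT cf).
  exists c; first by rewrite !ger0_norm.
  by rewrite -f0 -/(f h) E subr0 mulrC.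
- have [c /[!in_itv]/= /andP[ch c0] E] :=
    MVT_segment (ltW h0) (fun s _ => df s) (continuous_subspaceT cf).
  exists c; first by rewrite !ler0_norm ?lerN2// ltW.
  by rewrite -f0 -/(f h) -opprB E sub0r mulrN opprK mulrC.
Qed.

Lemma norm_scale_delta (c : R) i : `|c *: e_ i| <= `|c|.
Proof.
apply/row_normPle => // j; rewrite !mxE eqxx /=.
by case: eqP => _; rewrite ?mulr1// mulr0 normr0.
Qed.

Lemma is_derive_translate u (b y v : 'rV[R]_n) (df : R) : is_derive (b + y) v u df ->
  is_derive y v (fun z => u (b + z)) df.
Proof.
move=> /is_derive_lineP h; apply/is_derive_lineP.
rewrite (_ : (fun s : R => _) = (fun s : R => u (s *: v + (b + y)))) //.
by apply/funext => s; rewrite addrCA.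
Qed.

(** Two applications of the mean value theorem, first to the difference in the
direction i as a function of the j-th coordinate. *)
Lemma second_difference u i j x (h : R) : h != 0 -> derivable_everywhere u ->
  derivable_everywhere (partial j u) ->
  exists2 p, `|p - x| <= `|h| + `|h| &
    (u (h *: e_ i + (h *: e_ j + x)) - u (h *: e_ j + x)) - (u (h *: e_ i + x) - u x) =
    h * (h * partial i (partial j u) p).
Proof.
move=> h0 du duj; pose w := fun y => u (h *: e_ i + y) - u y.
have dw y k : is_derive y (e_ k) w (partial k u (h *: e_ i + y) - partial k u y).
  apply: is_derive_add; first exact/is_derive_translate/is_derive_partial.
  exact/is_derive_opp/is_derive_partial.
have dwe : derivable_everywhere w by move=> y k; have [] := dw y k.
have [c ch E] := partial_MVT x j h dwe.
have [c' ch' E'] := partial_MVT (c *: e_ j + x) i h duj.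
exists (c' *: e_ i + (c *: e_ j + x)).
  rewrite addrA addrK; apply: le_trans (ler_normD _ _) _.
  by apply: lerD; apply: le_trans (norm_scale_delta _ _) _.
rewrite -E' -/(w _) -/(w _) E; congr (_ * _).
by have [_ ] := dw (c *: e_ j + x) j; rewrite /partial => ->.
Qed.

Lemma third_add_third_lt (r : R) : 0 < r -> r / 3 + r / 3 < r.
Proof. by move=> r0; lra. Qed.

(** Both mixed derivatives are limits of the same second difference quotient. *)
Lemma partialC u i j : derivable_everywhere u ->
  derivable_everywhere (partial i u) -> derivable_everywhere (partial j u) ->
  continuous (partial i (partial j u)) -> continuous (partial j (partial i u)) ->
  partial i (partial j u) = partial j (partial i u).
Proof.
move=> du dui duj cij cji; apply/funext => x.
apply/eqP; rewrite -subr_eq0; apply/eqP/normr0_eq0/eqP; rewrite eq_le normr_ge0 andbT.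
apply/ler_addgt0Pl => e e0; rewrite addr0.
have e2 : 0 < e / 2 by rewrite divr_gt0.
have cijx : partial i (partial j u) y @[y --> x] --> partial i (partial j u) x by exact: cij.
have cjix : partial j (partial i u) y @[y --> x] --> partial j (partial i u) x by exact: cji.
move/cvgrPdist_lt/(_ _ e2)/nbhs_ballP : cijx => [d1 /= d10 b1].
move/cvgrPdist_lt/(_ _ e2)/nbhs_ballP : cjix => [d2 /= d20 b2].
(* The points given by the two mean value arguments are at distance at most
   2 h = 2 d / 3 of x. *)
pose d := Num.min d1 d2; have d0 : 0 < d by rewrite lt_min d10.
pose h := d / 3; have h0 : 0 < h by rewrite divr_gt0.
have [p ph E] := second_difference i x (lt0r_neq0 h0) du duj.
have [q qh E'] := second_difference j x (lt0r_neq0 h0) du dui.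
have hd : `|h| + `|h| < d by rewrite gtr0_norm//; exact: third_add_third_lt.
have pd : ball x d1 p.
  rewrite -ball_normE /= distrC (le_lt_trans ph)// (lt_le_trans hd)//.
  by rewrite /d ge_min lexx.
have qd : ball x d2 q.
  rewrite -ball_normE /= distrC (le_lt_trans qh)// (lt_le_trans hd)//.
  by rewrite /d ge_min lexx orbT.
have pq : partial i (partial j u) p = partial j (partial i u) q.
  apply: (mulfI (lt0r_neq0 h0)); apply: (mulfI (lt0r_neq0 h0)).
  have swap (a b c r : R) : a - b - (c - r) = a - c - (b - r) by ring.
  have EE : u (h *: e_ i + (h *: e_ j + x)) = u (h *: e_ j + (h *: e_ i + x)).
    by rewrite addrCA.
  apply: (etrans (esym E)); apply: (etrans _ E'); rewrite EE; exact: swap.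
have hp := b1 _ pd; have hq := b2 _ qd.
have insert (a b r : R) : a - b = (a - r) - (b - r) by ring.
rewrite (insert _ _ (partial i (partial j u) p)).
apply: (le_trans (ler_normB _ _)); rewrite [leRHS](splitr e).
by apply: lerD; apply: ltW; [exact: hp|rewrite pq; exact: hq].
Qed.

End partials.

(** * Flat Schwartz functions *)

Section flat.
Variables (R : realType) (n : nat).
Implicit Types (u w : 'rV[R]_n -> R) (x y : 'rV[R]_n) (i j k : 'I_n).

Local Notation e_ i := (delta_mx 0 i : 'rV[R]_n).

(** The real-valued Schwartz functions all of whose derivatives vanish at the
origin.  All orders of differentiation are allowed, so that the class is
visibly stable under partial derivatives. *)
Definition flat u :=
  [/\ smooth_real u, forall s, foldr (@partial R n) u s 0 = 0 &
      forall (j : 'I_n -> nat) s, exists M, forall x,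
        `|monomial j x * foldr (@partial R n) u s x| <= M].

(** [flat] is the largest class of continuous, rapidly decreasing functions
vanishing at the origin which is stable under partial derivatives.  To prove a
closure property it is enough to exhibit a stable class. *)
Lemma flat_coind (P : ('rV[R]_n -> R) -> Prop) :
  (forall u, P u -> continuous u) ->
  (forall u, P u -> derivable_everywhere u) ->
  (forall u, P u -> u 0 = 0) ->
  (forall u, P u -> forall j : 'I_n -> nat, exists M, forall x, `|monomial j x * u x| <= M) ->
  (forall u i, P u -> P (partial i u)) ->
  forall u, P u -> flat u.
Proof.
move=> Pc Pd P0 Pb Pp u Pu.
have Ps s : P (foldr (@partial R n) u s) by elim: s => //= i s; exact: Pp.
by split=> [s|s|j s]; [split; [exact: Pc|exact: Pd]|exact: P0|exact: Pb].
Qed.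

Lemma flat_continuous u : flat u -> continuous u.
Proof. by move=> [/(_ [::])[]]. Qed.

Lemma flat_derivable u : flat u -> derivable_everywhere u.
Proof. by move=> [/(_ [::])[]]. Qed.

Lemma flat0 u : flat u -> u 0 = 0.
Proof. by move=> [_ /(_ [::])]. Qed.

Lemma flat_monomial_bounded u : flat u ->
  forall j : 'I_n -> nat, exists M, forall x, `|monomial j x * u x| <= M.
Proof. by move=> [_ _ +] j => /(_ j [::]). Qed.

Lemma monomial0 x : monomial (fun=> 0%N) x = 1.
Proof. by rewrite /monomial big1// => i _; rewrite expr0. Qed.

Lemma flat_bounded u : flat u -> exists M, forall x, `|u x| <= M.
Proof.
move=> /flat_monomial_bounded/(_ (fun=> 0%N))[M uM]; exists M => x.
by have := uM x; rewrite monomial0 mul1r.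
Qed.

Lemma flat_partial u i : flat u -> flat (partial i u).
Proof.
have E s : foldr (@partial R n) (partial i u) s = foldr (@partial R n) u (rcons s i).
  by rewrite -cats1 foldr_cat.
move=> [su u0 ub]; split=> [s|s|j s]; rewrite E; [exact: su|exact: u0|exact: ub].
Qed.

Lemma is_derive_coord x k i : is_derive x (e_ k) (fun y => y 0 i) (i == k)%:R.
Proof.
apply/is_derive_lineP.
rewrite (_ : (fun h : R => _) = (fun h => (i == k)%:R * h + x 0 i)).
  exact: is_derive_affine.
by apply/funext => h; rewrite !mxE mulrC.
Qed.

(** The module generated by the flat functions over the polynomials: by the
Leibniz rule it is stable under partial derivatives. *)
Inductive flat_module : ('rV[R]_n -> R) -> Prop :=
| flat_module_base u : flat u -> flat_module u
| flat_module_add u w : flat_module u -> flat_module w -> flat_module (fun x => u x + w x)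
| flat_module_scale c u : flat_module u -> flat_module (fun x => c * u x)
| flat_module_coord i u : flat_module u -> flat_module (fun x => x 0 i * u x).

Lemma monomial_coord (j : 'I_n -> nat) i x :
  monomial j x * x 0 i = monomial (fun k => (j k + (k == i))%N) x.
Proof.
rewrite /monomial (bigD1 i)//= [RHS](bigD1 i)//= eqxx addn1 exprSr -!mulrA; congr (_ * _).
rewrite mulrC; congr (_ * _); apply: eq_bigr => k /negbTE ki.
by rewrite ki addn0.
Qed.

Lemma flat_module_flat u : flat_module u -> flat u.
Proof.
apply: flat_coind => {u}.
- move=> u; elim=> {u} [u /flat_continuous//|u w _ cu _ cw|c u _ cu|i u _ cu].
  + exact: continuous_add.
  + by apply: continuous_mul => //; exact: continuous_const.
  + by apply: continuous_mul => //; exact: coord_continuous.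
- move=> u; elim=> {u} [u /flat_derivable//|u w _ du _ dw|c u _ du|i u _ du] x k.
  + by have [] := is_derive_add (is_derive_partial (du x k)) (is_derive_partial (dw x k)).
  + by have [] := is_derive_mull c (is_derive_partial (du x k)).
  + by have [] := is_derive_mul (is_derive_coord x k i) (is_derive_partial (du x k)).
- move=> u; elim=> {u} [u /flat0//|u w _ u0 _ w0|c u _ u0|i u _ u0].
  + by rewrite u0 w0 addr0.
  + by rewrite u0 mulr0.
  + by rewrite u0 mulr0.
- move=> u; elim=> {u} [u /flat_monomial_bounded//|u w _ bu _ bw|c u _ bu|i u _ bu] j.
  + have [M uM] := bu j; have [N wN] := bw j; exists (M + N) => x.
    by rewrite mulrDr (le_trans (ler_normD _ _))// lerD.
  + have [M uM] := bu j; exists (`|c| * M) => x.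
    by rewrite mulrCA normrM ler_wpM2l.
  + have [M uM] := bu (fun k => (j k + (k == i))%N); exists M => x.
    by rewrite mulrA monomial_coord.
- have key u : flat_module u -> forall k, derivable_everywhere u /\ flat_module (partial k u).
    elim=> {u} [u fu|u w _ du _ dw|c u _ du|i u mu0 du] k.
    + by split; [exact: flat_derivable|exact: (flat_module_base (flat_partial k fu))].
    + have [du1 mu1] := du k; have [dw1 mw1] := dw k.
      have D x l := is_derive_add (is_derive_partial (du1 x l)) (is_derive_partial (dw1 x l)).
      split; first by move=> x l; have [] := D x l.
      rewrite (_ : partial k _ = fun x => partial k u x + partial k w x).
        exact: flat_module_add.
      by apply/funext => x; have [_] := D x k.
    + have [du1 mu1] := du k.
      have D x l := is_derive_mull c (is_derive_partial (du1 x l)).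
      split; first by move=> x l; have [] := D x l.
      rewrite (_ : partial k _ = fun x => c * partial k u x).
        exact: flat_module_scale.
      by apply/funext => x; have [_] := D x k.
    + have [du1 mu1] := du k.
      have D x l := is_derive_mul (is_derive_coord x l i) (is_derive_partial (du1 x l)).
      split; first by move=> x l; have [] := D x l.
      rewrite (_ : partial k _ = fun x => x 0 i * partial k u x + (i == k)%:R * u x).
        apply: flat_module_add; first exact: flat_module_coord.
        exact: flat_module_scale.
      by apply/funext => x; rewrite [(i == k)%:R * _]mulrC; have [_] := D x k.
  by move=> u i /key/(_ i)[].
Qed.

Lemma flat_add u w : flat u -> flat w -> flat (fun x => u x + w x).
Proof. by move=> fu fw; apply/flat_module_flat/flat_module_add; exact: flat_module_base. Qed.

Lemma flat_scale c u : flat u -> flat (fun x => c * u x).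
Proof. by move=> fu; apply/flat_module_flat/flat_module_scale; exact: flat_module_base. Qed.

Lemma flat_coord i u : flat u -> flat (fun x => x 0 i * u x).
Proof. by move=> fu; apply/flat_module_flat/flat_module_coord; exact: flat_module_base. Qed.

Lemma flat_eq u w : u =1 w -> flat u -> flat w.
Proof. by move=> /funext ->. Qed.

Lemma flat_monomial (j : 'I_n -> nat) u : flat u -> flat (fun x => monomial j x * u x).
Proof.
move=> fu; rewrite /monomial.
elim: (index_enum _) => [|i s IH].
  by apply: flat_eq fu => x; rewrite big_nil mul1r.
have H m : flat (fun x => x 0 i ^+ m * (\prod_(i <- s) x 0 i ^+ j i * u x)).
  elim: m => [|m IHm]; first by apply: flat_eq IH => x; rewrite expr0 mul1r.
  by apply: flat_eq (flat_coord i IHm) => x; rewrite exprS mulrA.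
by apply: flat_eq (H (j i)) => x; rewrite big_cons mulrA.
Qed.

Lemma flat_sum (I : Type) (s : seq I) (F : I -> 'rV[R]_n -> R) u :
  flat u -> (forall a : I, flat (F a)) -> flat (fun x => \sum_(a <- s) F a x).
Proof.
move=> fu fF; elim: s => [|a s IH].
  by apply: flat_eq (flat_scale 0 fu) => x; rewrite big_nil mul0r.
by apply: flat_eq (flat_add (fF a) IH) => x; rewrite big_cons.
Qed.

Lemma flat_dotprod_pow N u : flat u -> flat (fun x => dotprod x x ^+ N * u x).
Proof.
move=> fu; elim: N => [|N IH]; first by apply: flat_eq fu => x; rewrite expr0 mul1r.
have := flat_sum (index_enum 'I_n) IH (fun i => flat_coord i (flat_coord i IH)).
by apply: flat_eq => x; rewrite exprS -mulrA /dotprod mulr_suml; apply: eq_bigr => i _; rewrite mulrA.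
Qed.

(** Bounds are obtained for polynomial multiples; this turns them into
domination by the integrable Cauchy weight. *)
Lemma prod_oneDsqr_le_cauchy x (a M : R) :
  `|\prod_(i < n) (1 + x 0 i ^+ 2) * a| <= M -> `|a| <= M * coord_prod (@cauchy1 R) x.
Proof.
move=> aM; rewrite /coord_prod.
have p0 : 0 < \prod_(i < n) (1 + x 0 i ^+ 2).
  by apply: prodr_gt0 => i _; exact: oneDsqr_gt0.
have M0 : 0 <= M by apply: le_trans aM.
have hE : \prod_(i < n) cauchy1 (x 0 i) * \prod_(i < n) (1 + x 0 i ^+ 2) = 2 ^+ n.
  rewrite -big_split /= (eq_bigr (fun=> 2)) => [|i _]; first by rewrite prodr_const card_ord.
  by rewrite /cauchy1 divfK// gt_eqF// oneDsqr_gt0.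
rewrite -(ler_pM2l p0) mulrCA (mulrC _ (\prod_(i < n) cauchy1 _)) hE.
move: aM; rewrite normrM (gtr0_norm p0) => /le_trans; apply.
by rewrite ler_peMr// exprn_ege1// ler1n.
Qed.

Lemma flat_cauchy_bounded u : flat u ->
  exists C, forall x, `|u x| <= C * coord_prod (@cauchy1 R) x.
Proof.
move=> fu.
have : flat (fun x => \prod_(i < n) (1 + x 0 i ^+ 2) * u x).
  elim: (index_enum _) => [|i s IH].
    by apply: flat_eq fu => x; rewrite big_nil mul1r.
  apply: flat_eq (flat_add IH (flat_coord i (flat_coord i IH))) => x.
  by rewrite big_cons; ring.
by move=> /flat_bounded[M uM]; exists M => x; exact: prod_oneDsqr_le_cauchy.
Qed.

End flat.

(** * Oscillating powers of the Euclidean norm *)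

Section flat_power.
Variables (R : realType) (n : nat).
Implicit Types (u w h : 'rV[R]_n -> R) (x y : 'rV[R]_n) (i j k : 'I_n).

Local Notation e_ i := (delta_mx 0 i : 'rV[R]_n).

(** The vertices of a path from 0 to x along the coordinate axes, on which the
mean value theorem can be used with partial derivatives only. *)
Definition truncate_row x (m : nat) : 'rV[R]_n := \row_j (if (j < m)%N then x 0 j else 0).

(** Induction on N: the partial derivatives are flat too, and the mean value
theorem along a path from the origin gains one power of the norm. *)
Lemma flat_le_norm_pow u (N : nat) : flat u -> exists C, forall x, `|u x| <= C * `|x| ^+ N.
Proof.
elim: N u => [|N IH] u fu.
  by have [M uM] := flat_bounded fu; exists M => x; rewrite expr0 mulr1.
have [C uC] := choice (fun i => IH _ (flat_partial i fu)).
exists (\sum_i `|C i|) => x.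
have step (m : nat) : (m <= n)%N ->
    `|u (truncate_row x m)| <= (\sum_(i < n | (i < m)%N) `|C i|) * `|x| ^+ N.+1.
  elim: m => [|m IHm] mn.
    rewrite big_pred0// mul0r (_ : truncate_row x 0 = 0) ?(flat0 fu) ?normr0//.
    by apply/rowP => j; rewrite !mxE.
  pose i := Ordinal mn.
  have -> : truncate_row x m.+1 = x 0 i *: e_ i + truncate_row x m.
    apply/rowP => j; rewrite !mxE eqxx /= ltnS leq_eqVlt.
    have [->|ji] := eqVneq j i; first by rewrite eqxx ltnn mulr1 addr0.
    have -> : (j == m :> nat) = false.
      by apply/negbTE; apply: contra ji => /eqP jm; apply/eqP; exact: val_inj.
    by rewrite /= mulr0 add0r.
  have [c cx E] := partial_MVT (truncate_row x m) i (x 0 i) (flat_derivable fu).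
  have xn j : `|x 0 j| <= `|x| by exact: (row_normPle x (normr_ge0 x)).1.
  have zn : `|c *: e_ i + truncate_row x m| <= `|x|.
    apply/row_normPle => // j; rewrite !mxE eqxx /=.
    have [->|ji] := eqVneq j i; first by rewrite ltnn mulr1 addr0 (le_trans cx).
    by rewrite /= mulr0 add0r; case: ifP => _; rewrite ?normr0.
  rewrite (bigD1 i) ?leqnn//= mulrDl.
  rewrite -[u _](subrK (u (truncate_row x m))) E.
  rewrite (le_trans (ler_normD _ _))// lerD//.
    rewrite normrM exprS mulrCA ler_pM// (le_trans (uC _ _))//.
    apply: (@le_trans _ _ (`|C i| * `|c *: e_ i + truncate_row x m| ^+ N)).
      by rewrite ler_wpM2r ?exprn_ge0// ler_norm.
    by rewrite ler_wpM2l// lerXn2r// nnegrE.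
  rewrite (le_trans (IHm (ltnW mn)))// ler_wpM2r ?exprn_ge0//.
  rewrite le_eqVlt; apply/orP; left; apply/eqP; apply: eq_bigl => j.
  by rewrite ltnS [in RHS]leq_eqVlt -val_eqE /=; case: ltngtP.
have := step n (leqnn n).
rewrite (_ : truncate_row x n = x); last by apply/rowP => j; rewrite !mxE ltn_ord.
by rewrite (eq_bigl predT)// => j; rewrite ltn_ord.
Qed.

(** The logarithm of the Euclidean norm, written with the square of the norm,
which is a polynomial. *)
Definition log_enorm x : R := ln (dotprod x x) / 2.

(** The real part of |x|^(a + i c), with a phase d which also yields the
imaginary part and the derivatives.  As ln 0 = 0, the value at the origin is
cos d, and a product with a function vanishing at the origin vanishes there. *)
Definition oscillating_power (a c d : R) x : R :=
  expR (a * log_enorm x) * cos (c * log_enorm x + d).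

Lemma dotprod_ge0 x : 0 <= dotprod x x.
Proof. by apply: sumr_ge0 => i _; exact: sqr_ge0. Qed.

Lemma dotprod_eq0 x : dotprod x x = 0 -> x = 0.
Proof.
move=> /psumr_eq0P h; apply/rowP => i; rewrite mxE; apply/eqP.
by rewrite -sqrf_eq0 expr2 h// => j _; rewrite -expr2 sqr_ge0.
Qed.

Lemma dotprod_gt0 x : x != 0 -> 0 < dotprod x x.
Proof.
by move=> x0; rewrite lt_neqAle dotprod_ge0 andbT eq_sym; apply: contra_neq x0 => /dotprod_eq0.
Qed.

Lemma expR_log_enorm_sqr x : x != 0 -> expR (log_enorm x) ^+ 2 = dotprod x x.
Proof.
move=> x0; rewrite -expRM_natl mulrC divfK// lnK// posrE; exact: dotprod_gt0.
Qed.

Lemma expRN_log_enorm x : x != 0 -> expR (- 2 * log_enorm x) = (dotprod x x)^-1.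
Proof. by move=> x0; rewrite mulNr expRN (expRM_natl 2) expR_log_enorm_sqr. Qed.

Lemma norm_le_expR_log_enorm x : x != 0 -> `|x| <= expR (log_enorm x).
Proof.
move=> x0; apply/row_normPle; first exact: expR_ge0.
move=> i; rewrite -ler_sqr ?nnegrE ?expR_ge0// expR_log_enorm_sqr//.
rewrite real_normK ?num_real// /dotprod (bigD1 i)//= -expr2 lerDl.
by apply: sumr_ge0 => j _; exact: sqr_ge0.
Qed.

Lemma is_derive_dotprod x i : is_derive x (e_ i) (fun y => dotprod y y) (2 * x 0 i).
Proof.
apply/is_derive_lineP.
have E : (fun t : R => dotprod (t *: e_ i + x) (t *: e_ i + x)) =
    (fun t => t * t + (2 * x 0 i * t + dotprod x x)).
  apply/funext => t.
  have -> : dotprod (t *: e_ i + x) (t *: e_ i + x) =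
      t * (t * dotprod (e_ i) (e_ i)) + 2 * (t * dotprod (e_ i) x) + dotprod x x.
    rewrite !dotprodDr !dotprodDl !dotprodZr !dotprodZl (dotprodC x (e_ i)).
    by ring.
  have D z : dotprod (e_ i) z = z 0 i.
    rewrite /dotprod (bigD1 i)//= big1 => [|j ji].
      by rewrite mxE !eqxx mul1r addr0.
    by rewrite mxE (negbTE ji) andbF mul0r.
  by rewrite !D mxE !eqxx /=; ring.
rewrite E.
have h1 := is_derive_mul (is_derive_id (0 : R) (1 : R)) (is_derive_id (0 : R) (1 : R)).
have h2 := is_derive_affine (2 * x 0 i) (dotprod x x) 0.
by apply: (is_derive_eq (is_derive_add h1 h2)); rewrite /= !mul0r !add0r.
Qed.

Lemma is_derive_log_enorm x i : x != 0 ->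
  is_derive x (e_ i) log_enorm (x 0 i * expR (- 2 * log_enorm x)).
Proof.
move=> x0; have s0 := dotprod_gt0 x0; rewrite expRN_log_enorm//.
have h := is_derive_mull 2^-1 (is_derive_chain (f := fun y => dotprod y y)
  (is_derive1_ln s0) (is_derive_dotprod x i)).
rewrite (_ : log_enorm = fun y => 2^-1 * ln (dotprod y y)); last first.
  by apply/funext => y; rewrite /log_enorm mulrC.
apply: (is_derive_eq h).
by field; rewrite gt_eqF.
Qed.

(** Differentiation lowers the exponent by 2, brings a factor x_i and shifts the
phase: the family of oscillating powers is stable. *)
Lemma is_derive_oscillating_power (a c d : R) x i : x != 0 ->
  is_derive x (e_ i) (oscillating_power a c d)
    (x 0 i * (a * oscillating_power (a - 2) c d x +
              c * oscillating_power (a - 2) c (d + pi / 2) x)).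
Proof.
move=> x0; have hL := is_derive_log_enorm i x0.
have hE := is_derive_chain (f := fun y => a * log_enorm y) (is_derive_expR (a * log_enorm x)) (is_derive_mull a hL).
have hA := is_derive_add (is_derive_mull c hL) (is_derive_const x (e_ i) d).
have hC := is_derive_chain (f := fun y => c * log_enorm y + d)
   (is_derive_cos (c * log_enorm x + d)) hA.
apply: (is_derive_eq (is_derive_mul hE hC)).
rewrite /oscillating_power addrA cosDpihalf (_ : (a - 2) * _ = a * log_enorm x + (- 2) * log_enorm x).
  by rewrite expRD; ring.
by ring.
Qed.

Lemma continuous_at_oscillating_power (a c d : R) x : x != 0 ->
  {for x, continuous (oscillating_power a c d)}.
Proof.
move=> x0.
have cL : {for x, continuous log_enorm}.
  apply: (@continuous_comp _ _ _ (fun y => dotprod y y) (fun t : R => ln t / 2)).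
    apply: continuous_big => [|i _].
      by move=> [p q]; apply: cvgD; [exact: cvg_fst|exact: cvg_snd].
    by apply: continuous_mul; exact: coord_continuous.
  apply: cvgM; last exact: cvg_cst.
  by apply: continuous_ln; exact: dotprod_gt0.
apply: (@continuous_comp _ _ _ log_enorm (fun t : R => expR (a * t) * cos (c * t + d))) => //.
apply: continuous_mul.
  by apply: continuous_chain; [exact: mulrl_continuous|exact: continuous_expR].
apply: continuous_chain; last exact: continuous_cos.
by apply: continuous_add; [exact: mulrl_continuous|exact: continuous_const].
Qed.

(** Near the origin the flatness of h compensates a negative exponent; far from
it the rapid decrease of h compensates a positive one. *)
Lemma oscillating_power_flat_bounded (a c d : R) h : flat h ->
  exists C, forall x, `|oscillating_power a c d x * h x| <= C.
Proof.
move=> fh.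
have [N aN] : exists N : nat, `|a| <= N%:R.
  by exists (Num.bound `|a|); exact: ltW (archi_boundP (normr_ge0 a)).
have [C hC] := flat_le_norm_pow N fh.
have [M hM] := flat_bounded (flat_dotprod_pow N fh).
have C0 : 0 <= `|C| by [].
exists (Num.max `|C| M) => x; rewrite le_max.
have [->|x0] := eqVneq x 0; first by rewrite (flat0 fh) mulr0 normr0 C0.
have QE : `|oscillating_power a c d x| <= expR (a * log_enorm x).
  by rewrite normrM (ger0_norm (expR_ge0 _)) ler_piMr ?expR_ge0// cos_max.
rewrite normrM.
set L := log_enorm x in QE *.
have [L0|L0] := leP L 0; apply/orP; [left|right].
- have QL : expR (a * L) <= expR (- (N%:R * L)).
    rewrite ler_expR -mulrN.
    have : a * L <= `|a| * - L.
      by rewrite -[- L]ler0_norm// -normrM ler_norm.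
    by move=> /le_trans; apply; rewrite ler_wpM2r// oppr_ge0.
  have hN : `|h x| <= `|C| * expR (N%:R * L).
    rewrite (le_trans (hC x))// expRM_natl.
    apply: (@le_trans _ _ (`|C| * `|x| ^+ N)).
      by rewrite ler_wpM2r ?exprn_ge0// ler_norm.
    by rewrite ler_wpM2l// lerXn2r ?nnegrE ?expR_ge0// norm_le_expR_log_enorm.
  apply: (@le_trans _ _ (expR (- (N%:R * L)) * (`|C| * expR (N%:R * L)))).
    by apply: ler_pM => //; exact: le_trans QE QL.
  by rewrite mulrCA -expRD addNr expR0 mulr1.
- have QL : expR (a * L) <= dotprod x x ^+ N.
    rewrite -expR_log_enorm_sqr// -!expRM_natl ler_expR -/L.
    have : a * L <= N%:R * L.
      by rewrite ler_wpM2r ?(ltW L0)// (le_trans (ler_norm _)).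
    move=> /le_trans; apply; rewrite ler_wpM2l//.
    by rewrite ler_peMl ?(ltW L0)// ler1n.
  apply: le_trans (hM x); rewrite [leRHS]normrM ler_wpM2r//.
  by rewrite (le_trans QE)// (le_trans QL)// ler_norm.
Qed.

(** The bound for the exponent a - 2, multiplied by |x|^2. *)
Lemma oscillating_power_flat_le (a c d : R) h : flat h ->
  exists C, forall x, `|oscillating_power a c d x * h x| <= C * dotprod x x.
Proof.
move=> fh; have [C hC] := oscillating_power_flat_bounded (a - 2) c d fh.
exists C => x; have [->|x0] := eqVneq x 0.
  rewrite (flat0 fh) mulr0 normr0 mulr_ge0 ?dotprod_ge0//.
  exact: le_trans (normr_ge0 _) (hC 0).
have -> : oscillating_power a c d x = dotprod x x * oscillating_power (a - 2) c d x.
  rewrite /oscillating_power mulrA -expR_log_enorm_sqr// -(expRM_natl 2) -expRD.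
  by congr (expR _ * _); ring.
by rewrite -mulrA normrM (ger0_norm (dotprod_ge0 _)) mulrC ler_wpM2r ?dotprod_ge0.
Qed.

(** This handles the origin, where the power itself has no derivative. *)
Lemma is_derive_quadratic u x v (C : R) : (forall t : R, `|u (t *: v + x) - u x| <= C * t ^+ 2) ->
  is_derive x v u 0.
Proof.
move=> uC.
have C0 : 0 <= C by have := uC 1; rewrite expr1n mulr1; exact: le_trans.
have h : t^-1 *: ((u \o shift x) (t *: v) - u x) @[t --> 0^'] --> (0 : R).
  apply/cvgrPdist_le => e e0.
  have C1 : 0 < C + 1 by rewrite ltr_wpDl.
  exists (e / (C + 1)); first by rewrite /= divr_gt0.
  move=> t /=; rewrite !sub0r !normrN => te t0.
  rewrite [_ *: _]/(_ * _) normrM normfV.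
  have tn : 0 < `|t| by rewrite normr_gt0.
  rewrite ler_pdivrMl//.
  rewrite (le_trans (uC t))// -real_normK ?num_real// expr2 mulrCA ler_wpM2l//.
  have := ltW te; rewrite ler_pdivlMr// => /(le_trans _); apply.
  by rewrite mulrC ler_wpM2l// lerDl.
by split; [apply/cvg_ex; exists 0|apply: cvg_lim].
Qed.

Lemma is_derive_oscillating_power_flat (a c d : R) h x i : flat h ->
  is_derive x (e_ i) (fun y => oscillating_power a c d y * h y)
    (oscillating_power a c d x * partial i h x +
     (oscillating_power (a - 2) c d x * (a * (x 0 i * h x)) +
      oscillating_power (a - 2) c (d + pi / 2) x * (c * (x 0 i * h x)))).
Proof.
move=> fh; have [->|x0] := eqVneq x 0.
  rewrite (flat0 fh) (flat0 (flat_partial i fh)) !mulr0 !addr0.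
  have [C hC] := oscillating_power_flat_le a c d fh.
  apply: (is_derive_quadratic (C := C)) => t.
  rewrite (flat0 fh) mulr0 subr0 addr0 (le_trans (hC _))//.
  rewrite (_ : dotprod (t *: e_ i) (t *: e_ i) = t ^+ 2)//.
  rewrite dotprodZr dotprodZl mulrA -expr2 (_ : dotprod _ _ = 1) ?mulr1//.
  rewrite /dotprod (bigD1 i)//= big1 => [|j ji]; first by rewrite mxE !eqxx mulr1 addr0.
  by rewrite mxE (negbTE ji) andbF mul0r.
have dh : is_derive x (e_ i) h (partial i h x).
  by apply: is_derive_partial; exact: flat_derivable.
apply: (is_derive_eq (is_derive_mul (is_derive_oscillating_power a c d i x0) dh)).
by ring.
Qed.

(** Sums of products of an oscillating power of fixed frequency c and a flat
function: the class to which [flat_coind] is applied. *)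
Inductive oscillating (c : R) : ('rV[R]_n -> R) -> Prop :=
| oscillating_base a d h : flat h -> oscillating c (fun x => oscillating_power a c d x * h x)
| oscillating_add u w : oscillating c u -> oscillating c w -> oscillating c (fun x => u x + w x).

Lemma oscillating_partial c u i : oscillating c u ->
  derivable_everywhere u /\ oscillating c (partial i u).
Proof.
move=> ou; elim: ou i => {u} [a d h fh|u w _ IHu _ IHw] i.
  have D y k := is_derive_oscillating_power_flat a c d y k fh.
  split; first by move=> y k; have [] := D y k.
  rewrite (_ : partial i _ = fun x => oscillating_power a c d x * partial i h x +
     (oscillating_power (a - 2) c d x * (a * (x 0 i * h x)) +
      oscillating_power (a - 2) c (d + pi / 2) x * (c * (x 0 i * h x)))).
    apply: oscillating_add; first exact/oscillating_base/flat_partial.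
    apply: oscillating_add.
      exact/oscillating_base/flat_scale/flat_coord.
    exact/oscillating_base/flat_scale/flat_coord.
  by apply/funext => x; have [_] := D x i.
have [du ou1] := IHu i; have [dw ow1] := IHw i.
have D y k := is_derive_add (is_derive_partial (du y k)) (is_derive_partial (dw y k)).
split; first by move=> y k; have [] := D y k.
rewrite (_ : partial i _ = fun x => partial i u x + partial i w x).
  exact: oscillating_add.
by apply/funext => x; have [_] := D x i.
Qed.

Lemma oscillating_flat c u : oscillating c u -> flat u.
Proof.
apply: flat_coind => {u} [u|u|u|u|u i].
- elim=> {u} [a d h fh x|u w _ cu _ cw]; last exact: continuous_add.
  have [->|x0] := eqVneq x 0; last first.
    have h1 : oscillating_power a c d y @[y --> x] --> oscillating_power a c d x.
      exact: continuous_at_oscillating_power.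
    have h2 : h y @[y --> x] --> h x by exact: flat_continuous.
    exact: (cvgM h1 h2).
  have [C hC] := oscillating_power_flat_le a c d fh.
  have s0 : C * dotprod y y @[y --> (0 : 'rV[R]_n)] --> (0 : R).
    have : continuous (fun y : 'rV[R]_n => C * dotprod y y).
      apply: continuous_mul; first exact: continuous_const.
      apply: continuous_big => [|j _].
        by move=> [p q]; apply: cvgD; [exact: cvg_fst|exact: cvg_snd].
      by apply: continuous_mul; exact: coord_continuous.
    move=> cs; have h0 : C * dotprod y y @[y --> (0 : 'rV[R]_n)] --> C * dotprod (0 : 'rV[R]_n) 0.
      exact: cs.
    have d0 : dotprod (0 : 'rV[R]_n) 0 = 0.
      by apply: big1 => j _; rewrite mxE mul0r.
    by rewrite d0 mulr0 in h0.
  have Z : oscillating_power a c d 0 * h 0 = 0 by rewrite (flat0 fh) mulr0.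
  suff : oscillating_power a c d y * h y @[y --> (0 : 'rV[R]_n)] --> (0 : R) by rewrite -[X in _ --> X -> _]Z.
  apply/(cvgrPdist_le (FF := nbhs_filter (0 : 'rV[R]_n))) => e e0.
  move/(cvgrPdist_le (FF := nbhs_filter (0 : 'rV[R]_n)))/(_ _ e0) : s0; apply: (@filterS _ _ (nbhs_filter (0 : 'rV[R]_n))) => y.
  rewrite !sub0r !normrN => /(le_trans (ler_norm _)); apply: le_trans.
  exact: hC.
- by move=> ou x i; have [du _] := oscillating_partial i ou; exact: du.
- by elim=> {u} [a d h fh|u w _ u0 _ w0]; rewrite ?(flat0 fh) ?mulr0// u0 w0 addr0.
- elim=> {u} [a d h fh|u w _ bu _ bw] j.
    have [C hC] := oscillating_power_flat_bounded a c d (flat_monomial j fh).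
    by exists C => x; rewrite mulrCA.
  have [M uM] := bu j; have [N wN] := bw j; exists (M + N) => x.
  by rewrite mulrDr (le_trans (ler_normD _ _))// lerD.
- by move=> ou; have [] := oscillating_partial i ou.
Qed.

Theorem flat_oscillating_power (a c d : R) h : flat h ->
  flat (fun x => oscillating_power a c d x * h x).
Proof. by move=> fh; apply/oscillating_flat/oscillating_base. Qed.

End flat_power.

(** * Decay of the cosine transform *)

Section transform_decay.
Variables (R : realType) (n : nat).
Implicit Types (u w h : 'rV[R]_n -> R) (x y xi : 'rV[R]_n) (i j : 'I_n).

Local Notation e_ i := (delta_mx 0 i : 'rV[R]_n).
Local Notation cauchy := (coord_prod (@cauchy1 R)).

(** The difference quotients of a function dominated by the Cauchy weight are
dominated by a multiple of that weight, which does not depend on the step. *)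
Lemma cauchy1_shift (x t : R) : `|t| <= 1 -> cauchy1 (t + x) <= 3 * cauchy1 x.
Proof.
move=> t1; rewrite /cauchy1 mulrCA ler_pM2l// ler_pdivlMr ?oneDsqr_gt0//.
rewrite ler_pdivrMl ?oneDsqr_gt0//.
have t2 : t ^+ 2 <= 1 by rewrite -real_normK ?num_real// expr_le1.
have := sqr_ge0 (x + 2 * t); nra.
Qed.

Lemma cauchy_shift (c : R) i x : `|c| <= 1 -> cauchy (c *: e_ i + x) <= 3 ^+ n * cauchy x.
Proof.
move=> c1; rewrite (_ : 3 ^+ n = \prod_(j < n) 3); last by rewrite prodr_const card_ord.
rewrite /coord_prod -big_split /=; apply: ler_prod => j _.
rewrite cauchy1_ge0 /= !mxE; apply: cauchy1_shift.
by rewrite eqxx /=; case: eqP => _; rewrite ?mulr1// mulr0 normr0.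
Qed.

(** By translation invariance the difference quotients have integral 0, and they
converge dominatedly to the derivative. *)
Lemma rint_partial0 h i (C C' : R) : derivable_everywhere h -> continuous h ->
  continuous (partial i h) -> (forall x, `|h x| <= C * cauchy x) ->
  (forall x, `|partial i h x| <= C' * cauchy x) -> rint (partial i h) = 0.
Proof.
move=> dh ch cdh hC hC'.
have ih := rintegrable_cauchy_le (continuous_row_measurable ch) hC.
pose eps (k : nat) : R := k.+1%:R^-1.
have eps0 k : eps k != 0 by rewrite invr_neq0.
pose q (k : nat) x := k.+1%:R * (h (eps k *: e_ i + x) - h x).
have q0 k : rint (q k) = 0.
  have E x : h (eps k *: e_ i + x) = h (1 *: x + eps k *: e_ i) by rewrite scale1r addrC.
  have ih' : rintegrable (fun x => h (eps k *: e_ i + x)).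
    rewrite (_ : (fun x => _) = fun x => h (1 *: x + eps k *: e_ i)); last exact/funext.
    exact: rintegrable_affine.
  rewrite /q rintZ; last exact: rintegrableB.
  rewrite rintB// (eq_rint E) rint_affine// normr1 expr1n invr1 mul1r subrr mulr0//.
have C'0 : 0 <= C'.
  have := le_trans (normr_ge0 _) (hC' 0); rewrite pmulr_lge0//.
  by apply: prodr_gt0 => j _; exact: cauchy1_gt0.
have qE k x : exists2 c, `|c| <= eps k & q k x = partial i h (c *: e_ i + x).
  have [c cle E] := partial_MVT x i (eps k) dh.
  exists c; first by rewrite (le_trans cle)// ger0_norm ?invr_ge0.
  by rewrite /q E mulrA divff ?mul1r.
have qle k x : `|q k x| <= C' * 3 ^+ n * cauchy x.
  have [c cle ->] := qE k x.
  rewrite (le_trans (hC' _))// -mulrA ler_wpM2l//; apply: cauchy_shift.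
  by rewrite (le_trans cle)// invf_le1// ler1n.
have qcvg x : q k x @[k --> \oo] --> partial i h x.
  apply/cvgrPdist_lt => e e0.
  have cx : partial i h y @[y --> x] --> partial i h x by exact: cdh.
  move/cvgrPdist_lt/(_ _ e0)/nbhs_ballP : cx => [d /= d0 b].
  have := near_infty_natSinv_lt (PosNum d0); apply: filterS => k /= kd.
  have [c cle ->] := qE k x; apply: b.
  rewrite -ball_normE /= distrC addrK.
  exact: le_lt_trans (norm_scale_delta _ _) (le_lt_trans cle kd).
have cvg0 : rint (q k) @[k --> \oo] --> rint (partial i h).
  apply: (rint_dominated_cvg (w := fun x => C' * 3 ^+ n * cauchy x)).
  - move=> k; apply: measurable_funM => //; apply: measurable_funB.
      have := row_measurable_affine 1 (eps k *: e_ i) (continuous_row_measurable ch).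
      by under eq_fun do rewrite scale1r addrC.
    exact: continuous_row_measurable.
  - exact: continuous_row_measurable.
  - exact: qcvg.
  - exact/rintegrableZ/rintegrable_cauchy.
  - exact: qle.
rewrite -(cvg_lim _ cvg0)//; apply: cvg_lim => //.
by rewrite (_ : (fun k => rint (q k)) = fun=> 0); [exact: cvg_cst|exact/funext].
Qed.

Lemma flat_rintegrable u : flat u -> rintegrable u.
Proof.
move=> fu; have [C uC] := flat_cauchy_bounded fu.
exact: rintegrable_cauchy_le (continuous_row_measurable (flat_continuous fu)) uC.
Qed.

Lemma is_derive_cos_dotprod xi d x i :
  is_derive x (e_ i) (fun v => cos (dotprod xi v + d)) (- xi 0 i * sin (dotprod xi x + d)).
Proof.
have hd : is_derive x (e_ i) (fun v => dotprod xi v + d) (xi 0 i).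
  apply/is_derive_lineP.
  rewrite (_ : (fun t : R => _) = (fun t => xi 0 i * t + (dotprod xi x + d))).
    exact: is_derive_affine.
  apply/funext => t; rewrite dotprodDr dotprodZr addrA; congr (_ + _ + _).
  rewrite mulrC; congr (_ * _); rewrite /dotprod (bigD1 i)//= big1 => [|j ji].
    by rewrite mxE !eqxx mulr1 addr0.
  by rewrite mxE (negbTE ji) andbF mulr0.
have := is_derive_chain (f := fun v => dotprod xi v + d) (is_derive_cos (dotprod xi x + d)) hd.
by move=> h; apply: (is_derive_eq h); rewrite mulrC mulrN mulNr.
Qed.

(** Integration by parts. *)
Lemma cosine_transform_partial u i d xi : flat u ->
  cosine_transform (partial i u) d xi = xi 0 i * cosine_transform u (d - pi / 2) xi.
Proof.
move=> fu; have fdu := flat_partial i fu.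
have [C uC] := flat_cauchy_bounded fu; have [C' uC'] := flat_cauchy_bounded fdu.
pose h v := cos (dotprod xi v + d) * u v.
have D x k : is_derive x (e_ k) h
   (cos (dotprod xi x + d) * partial k u x - xi 0 k * (cos (dotprod xi x + (d - pi / 2)) * u x)).
  have du : is_derive x (e_ k) u (partial k u x).
    by apply: is_derive_partial; exact: flat_derivable.
  apply: (is_derive_eq (is_derive_mul (is_derive_cos_dotprod xi d x k) du)).
  by rewrite addrA cosBpihalf; ring.
have dE : partial i h = fun x =>
   cos (dotprod xi x + d) * partial i u x - xi 0 i * (cos (dotprod xi x + (d - pi / 2)) * u x).
  by apply/funext => x; have [_] := D x i.
have ch : continuous h.
  by apply: continuous_mul; [exact: continuous_cos_dotprod|exact: flat_continuous].
have i1 := rintegrable_cos xi d (flat_rintegrable fdu).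
have i2 := rintegrable_cos xi (d - pi / 2) (flat_rintegrable fu).
have : rint (partial i h) = 0.
  apply: (@rint_partial0 h i C (C' + `|xi 0 i| * C)).
  - by move=> x k; have [] := D x k.
  - exact: ch.
  - rewrite dE; apply: continuous_add.
      by apply: continuous_mul; [exact: continuous_cos_dotprod|exact: flat_continuous].
    have c2 : continuous (fun x => - xi 0 i * (cos (dotprod xi x + (d - pi / 2)) * u x)).
      apply: continuous_mul; first exact: continuous_const.
      by apply: continuous_mul; [exact: continuous_cos_dotprod|exact: flat_continuous].
    by under eq_fun do rewrite -mulNr.
  - by move=> x; rewrite /h normrM (le_trans _ (uC x))// ler_piMl// cos_max.
  - move=> x; rewrite dE; apply: le_trans (ler_normB _ _) _; rewrite [leRHS]mulrDl.
    apply: lerD.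
      by rewrite normrM (le_trans _ (uC' x))// ler_piMl// cos_max.
    rewrite normrM -mulrA; apply: ler_wpM2l; first exact: normr_ge0.
    by rewrite normrM (le_trans _ (uC x))// ler_piMl// cos_max.
rewrite dE rintB//; last exact: rintegrableZ.
by rewrite rintZ// => /eqP; rewrite subr_eq0 => /eqP.
Qed.

Lemma cosine_transform_pi u d xi : rintegrable u ->
  cosine_transform u (d - pi / 2 - pi / 2) xi = - cosine_transform u d xi.
Proof.
move=> iu; rewrite -[RHS]mulN1r /cosine_transform -rintZ; last exact: rintegrable_cos.
apply: eq_rint => v; rewrite addrA cosBpihalf addrA sinBpihalf; ring.
Qed.

(** The factor 1 + xi_i^2 is gained by applying 1 - d_i^2 to u, d_i being the i-th
partial derivative. *)
Lemma cosine_transform_decay_step u i : flat u ->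
  flat (fun x => u x - partial i (partial i u) x) /\
  forall d xi, cosine_transform (fun x => u x - partial i (partial i u) x) d xi =
    (1 + xi 0 i ^+ 2) * cosine_transform u d xi.
Proof.
move=> fu; have fdu := flat_partial i fu; have fddu := flat_partial i fdu.
split=> [|d xi].
  by apply: flat_eq (flat_add fu (flat_scale (-1) fddu)) => x; rewrite mulN1r.
have i1 := rintegrable_cos xi d (flat_rintegrable fu).
have i2 := rintegrable_cos xi d (flat_rintegrable fddu).
rewrite {1}/cosine_transform.
rewrite (@eq_rint _ _ _ (fun v => cos (dotprod xi v + d) * u v -
   cos (dotprod xi v + d) * partial i (partial i u) v)); last by move=> v; rewrite mulrBr.
rewrite rintB// -!/(cosine_transform _ _ _) !cosine_transform_partial//.
by rewrite cosine_transform_pi; [ring|exact: flat_rintegrable].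
Qed.

Lemma cosine_transform_cauchy_bounded u : flat u ->
  exists C, forall d xi, `|cosine_transform u d xi| <= C * cauchy xi.
Proof.
move=> fu.
have : exists2 w, flat w & forall d xi,
    cosine_transform w d xi = \prod_(i < n) (1 + xi 0 i ^+ 2) * cosine_transform u d xi.
  elim: (index_enum _) => [|i s [w fw wE]].
    by exists u => // d xi; rewrite big_nil mul1r.
  have [fw' w'E] := cosine_transform_decay_step i fw.
  by eexists; [exact: fw'|move=> d xi; rewrite w'E wE big_cons mulrA].
move=> [w fw wE].
have iw : rintegrable (fun v => `|w v|) by exact: integrable_norm (flat_rintegrable fw).
exists (rint (fun v => `|w v|)) => d xi.
have wle : `|cosine_transform w d xi| <= rint (fun v => `|w v|).
  apply: le_rint_norm => // [|v].
    exact: rintegrable_measurable (rintegrable_cos _ _ (flat_rintegrable fw)).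
  by rewrite normrM ler_piMl// cos_max.
by apply: prod_oneDsqr_le_cauchy; rewrite -wE.
Qed.

End transform_decay.

(** * The Lizorkin space in real terms *)

Section Psi_flat.
Variables (R : realType) (n : nat).
Implicit Types (u w : 'rV[R]_n -> R) (x : 'rV[R]_n) (i : 'I_n).

Lemma smooth_foldr u s : smooth_real u -> smooth_real (foldr (@partial R n) u s).
Proof. by move=> su t; rewrite -foldr_cat; exact: su. Qed.

Lemma smooth_partialC u i j : smooth_real u ->
  partial i (partial j u) = partial j (partial i u).
Proof.
move=> su; apply: partialC.
- by have [_] := su [::].
- by have [_] := su [:: i].
- by have [_] := su [:: j].
- by have [] := su [:: i; j].
- by have [] := su [:: j; i].
Qed.

Lemma foldr_partial_insert u i s t : smooth_real u ->
  foldr (@partial R n) u (s ++ i :: t) = partial i (foldr (@partial R n) u (s ++ t)).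
Proof.
move=> su; elim: s => //= j s ->; apply: smooth_partialC; exact: smooth_foldr.
Qed.

(** The order of differentiation does not matter for a smooth function; this
relates arbitrary sequences of derivatives to multi-indices. *)
Lemma foldr_partial_perm u s t : smooth_real u -> perm_eq s t ->
  foldr (@partial R n) u s = foldr (@partial R n) u t.
Proof.
move=> su; elim: s t => [|i s IH] t st; first by move: st; rewrite perm_sym => /perm_nilP ->.
have it : i \in t by rewrite -(perm_mem st) mem_head.
move: st; case/splitPr: it => t1 t2 st.
rewrite foldr_partial_insert//= (IH (t1 ++ t2))//.
by move: st; rewrite perm_sym perm_catC /= perm_cons perm_catC perm_sym.
Qed.

Lemma mpartial_real_foldr (k : 'I_n -> nat) u :
  mpartial_real k u = foldr (@partial R n) u (flatten [seq nseq (k i) i | i <- enum 'I_n]).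
Proof.
rewrite /mpartial_real; elim: (enum 'I_n) => //= i s ->.
by rewrite foldr_cat; elim: (k i) => //= m ->.
Qed.

Lemma count_flatten_nseq (k : 'I_n -> nat) i :
  count_mem i (flatten [seq nseq (k j) j | j <- enum 'I_n]) = k i.
Proof.
rewrite count_flatten sumnE big_map big_map big_enum /= (bigD1 i)//= big1 => [|j ji].
  by rewrite count_nseq /= eqxx mul1n addn0.
by rewrite count_nseq /= (negbTE ji).
Qed.

Lemma foldr_partial_mpartial u s : smooth_real u ->
  foldr (@partial R n) u s = mpartial_real (fun i => count_mem i s) u.
Proof.
move=> su; rewrite mpartial_real_foldr; apply: foldr_partial_perm => //.
by apply/allP => i _ /=; rewrite count_flatten_nseq.
Qed.

Lemma Re_real_mul (a : R) (z : R[i]) : complex.Re (a%:C * z) = a * complex.Re z.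
Proof. by case: z => x y /=; rewrite mul0r subr0. Qed.

Lemma Im_real_mul (a : R) (z : R[i]) : complex.Im (a%:C * z) = a * complex.Im z.
Proof. by case: z => x y /=; rewrite mul0r addr0. Qed.

Lemma normc_le (z : R[i]) (M : R) : `|z| <= M%:C -> `|complex.Re z| <= M /\ `|complex.Im z| <= M.
Proof.
rewrite normc_def lecR => zM.
split; apply: le_trans zM; rewrite -sqrtr_sqr ler_wsqrtr// ?lerDl ?lerDr sqr_ge0//.
Qed.

Lemma normc_le_ReIm (z : R[i]) : `|z| <= (`|complex.Re z| + `|complex.Im z|)%:C.
Proof.
case: z => a b; rewrite normc_def lecR /=.
rewrite -[leRHS]ger0_norm ?addr_ge0// -sqrtr_sqr ler_wsqrtr//.
rewrite sqrrD !real_normK ?num_real// -addrA lerD2l lerDr.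
by rewrite mulrn_wge0// mulr_ge0.
Qed.

(** Membership in Psi only involves the multi-indices in one fixed order, while
[flat] involves all sequences of derivatives. *)
Lemma Lizorkin_PsiP (psi : 'rV[R]_n -> R[i]) :
  Lizorkin_Psi psi <-> flat (fun x => complex.Re (psi x)) /\ flat (fun x => complex.Im (psi x)).
Proof.
split.
- move=> [[[sr si] b] z]; split; split=> [||j s]; rewrite ?foldr_partial_mpartial//.
  + by move=> s; rewrite foldr_partial_mpartial//; have [] := z (fun i => count_mem i s).
  + have [M hM] := b j (fun i => count_mem i s); exists M => x.
    by have [] := normc_le (hM x); rewrite Re_real_mul Im_real_mul.
  + by move=> s; rewrite foldr_partial_mpartial//; have [] := z (fun i => count_mem i s).
  + have [M hM] := b j (fun i => count_mem i s); exists M => x.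
    by have [] := normc_le (hM x); rewrite Re_real_mul Im_real_mul.
- move=> [[sr r0 rb] [si i0 ib]]; split; [split=> // j k|move=> k].
    have [M hM] := rb j (flatten [seq nseq (k i) i | i <- enum 'I_n]).
    have [N hN] := ib j (flatten [seq nseq (k i) i | i <- enum 'I_n]).
    exists (M + N) => x; apply: (le_trans (normc_le_ReIm _)).
    by rewrite lecR Re_real_mul Im_real_mul /mpartial /= !mpartial_real_foldr lerD.
  by rewrite /mpartial !mpartial_real_foldr r0 i0.
Qed.

Lemma monomial_scale (j : 'I_n -> nat) (t : R) x :
  monomial j (t *: x) = t ^+ (\sum_i j i) * monomial j x.
Proof.
rewrite /monomial expr_sum -big_split /=; apply: eq_bigr => i _.
by rewrite mxE exprMn.
Qed.

(** The chain rule for a homothety. *)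
Lemma is_derive_dilation u (t : R) x i : derivable u (t *: x) (delta_mx 0 i) ->
  is_derive x (delta_mx 0 i) (fun y => u (t *: y)) (t * partial i u (t *: x)).
Proof.
move=> du; apply/is_derive_lineP.
have h := (is_derive_lineP u (t *: x) _ _).1 (is_derive_partial du).
have h0 : is_derive ((fun s : R => t * s + 0) 0) 1 (fun s : R => u (s *: delta_mx 0 i + t *: x))
    (partial i u (t *: x)) by rewrite /= mulr0 addr0.
have hc := is_derive_chain (f := fun s => t * s + 0) h0 (is_derive_affine t 0 0).
have E : (fun s : R => u (t *: (s *: delta_mx 0 i + x))) =
    (fun s : R => u ((t * s + 0) *: delta_mx 0 i + t *: x)).
  by apply/funext => s; rewrite addr0 scalerDr scalerA.
by rewrite E [t * _]mulrC; exact: hc.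
Qed.

Lemma flat_dilation u (t : R) : t != 0 -> flat u -> flat (fun x => u (t *: x)).
Proof.
move=> t0 fu.
pose P w := exists2 h, flat h & w = fun x => h (t *: x).
apply: (@flat_coind R n P); last by exists u.
- move=> _ [h fh ->] x; apply: (@continuous_comp _ _ _ (fun x => t *: x) h).
    exact: scaler_continuous.
  exact: flat_continuous.
- move=> _ [h fh ->] x i.
  by have [] := is_derive_dilation (@flat_derivable _ _ _ fh (t *: x) i).
- by move=> _ [h fh ->]; rewrite scaler0 flat0.
- move=> _ [h fh ->] j; have [M hM] := flat_monomial_bounded fh j.
  exists (`|t ^- (\sum_i j i)| * M) => x.
  rewrite -[monomial j x](mulKf (expf_neq0 (\sum_i j i) t0)) -monomial_scale -mulrA normrM.
  by rewrite ler_wpM2l.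
- move=> _ i [h fh ->]; exists (fun x => t * partial i h x).
    exact/flat_scale/flat_partial.
  apply/funext => x.
  by have [_] := is_derive_dilation (@flat_derivable _ _ _ fh (t *: x) i).
Qed.

End Psi_flat.

(** * Complex integrals and Fourier inversion *)

Section complex_integral.
Variables (R : realType) (n : nat).
Implicit Types (phi psi G : 'rV[R]_n -> R[i]) (xi x y : 'rV[R]_n).
Local Notation cauchy := (coord_prod (@cauchy1 R)).

Definition cintegrable G :=
  rintegrable (fun x => complex.Re (G x)) /\ rintegrable (fun x => complex.Im (G x)).

Lemma integral_RnE G : integral_Rn G =
  rint (fun x => complex.Re (G x)) +i* rint (fun x => complex.Im (G x)).
Proof. by []. Qed.

Lemma integral_RnZ (c : R[i]) G : cintegrable G ->
  integral_Rn (fun x => c * G x) = c * integral_Rn G.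
Proof.
case: c => a b [i1 i2]; rewrite !integral_RnE /=.
have e1 : rint (fun x => complex.Re ((a +i* b) * G x)) =
    a * rint (fun x => complex.Re (G x)) - b * rint (fun x => complex.Im (G x)).
  rewrite -!rintZ// -rintB; try exact: rintegrableZ.
  by apply: eq_rint => x; case: (G x).
have e2 : rint (fun x => complex.Im ((a +i* b) * G x)) =
    a * rint (fun x => complex.Im (G x)) + b * rint (fun x => complex.Re (G x)).
  rewrite -!rintZ// -rintD; try exact: rintegrableZ.
  by apply: eq_rint => x; case: (G x).
by rewrite e1 e2.
Qed.

Lemma cintegrable_scale (t : R) G : t != 0 -> cintegrable G ->
  cintegrable (fun x => G (t *: x)).
Proof.
move=> t0 [i1 i2]; split.
  have := rintegrable_affine 0 t0 i1.
  by rewrite /rintegrable; under eq_fun do rewrite addr0.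
have := rintegrable_affine 0 t0 i2.
by rewrite /rintegrable; under eq_fun do rewrite addr0.
Qed.

Lemma integral_Rn_scale (t : R) G : t != 0 -> cintegrable G ->
  integral_Rn (fun x => G (t *: x)) = (`|t| ^- n)%:C * integral_Rn G.
Proof.
move=> t0 [i1 i2]; rewrite !integral_RnE.
have := rint_affine 0 t0 i1; under eq_rint do rewrite addr0; move=> ->.
have := rint_affine 0 t0 i2; under eq_rint do rewrite addr0; move=> ->.
by apply/eqP; rewrite eq_complex /= !mul0r subr0 addr0 !eqxx.
Qed.

Lemma eq_integral_Rn phi psi : phi =1 psi -> integral_Rn phi = integral_Rn psi.
Proof. by move=> /funext ->. Qed.

Lemma expi_mulE (a : R) (z : R[i]) : expi a * z =
  (cos (a + 0) * complex.Re z + cos (a + pi / 2) * complex.Im z) +i*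
  (cos (a + 0) * complex.Im z + cos (a + - (pi / 2)) * complex.Re z).
Proof.
by case: z => x y; rewrite /expi addr0 cosDpihalf cosBpihalf mulNr; apply/eqP;
  rewrite eq_complex /= !eqxx.
Qed.

Lemma cintegrable_expi x psi : cintegrable psi -> cintegrable (fun xi => expi (dotprod x xi) * psi xi).
Proof.
move=> [i1 i2]; split; under eq_fun do rewrite expi_mulE /=.
  exact: rintegrableD (rintegrable_cos _ _ i1) (rintegrable_cos _ _ i2).
exact: rintegrableD (rintegrable_cos _ _ i2) (rintegrable_cos _ _ i1).
Qed.

Lemma FourierE psi xi : cintegrable psi -> Fourier psi xi =
  (cosine_transform (fun x => complex.Re (psi x)) 0 xi +
   cosine_transform (fun x => complex.Im (psi x)) (pi / 2) xi) +i*
  (cosine_transform (fun x => complex.Im (psi x)) 0 xi +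
   cosine_transform (fun x => complex.Re (psi x)) (- (pi / 2)) xi).
Proof.
move=> [i1 i2]; rewrite /Fourier integral_RnE /cosine_transform.
rewrite -!rintD; try exact: rintegrable_cos.
by congr (_ +i* _); apply: eq_rint => x; rewrite expi_mulE.
Qed.

Lemma Psi_cintegrable psi : Lizorkin_Psi psi -> cintegrable psi.
Proof. by move=> /Lizorkin_PsiP[f1 f2]; split; exact: flat_rintegrable. Qed.

Lemma flat_inversion (u : 'rV[R]_n -> R) (eta : 'rV[R]_n) d e : flat u ->
  rint (fun xi => cos (dotprod eta xi + e) * cosine_transform u d xi) =
  (2 * pi) ^+ n / 2 * (cos (d + e) * u (- eta) + cos (d - e) * u eta).
Proof.
move=> fu; have [C uC] := flat_cauchy_bounded fu.
have [C' uC'] := cosine_transform_cauchy_bounded fu.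
exact: (cosine_inversion (flat_continuous fu) uC uC').
Qed.

Lemma rintegrable_cosine_transform (u : 'rV[R]_n -> R) d : flat u ->
  rintegrable (cosine_transform u d).
Proof.
move=> fu; have [C' uC'] := cosine_transform_cauchy_bounded fu.
exact: (rintegrable_cauchy_le (measurable_cosine_transform d (flat_rintegrable fu)) (uC' d)).
Qed.

(** The real inversion formula is applied to the four transforms which make up
F psi; the terms at xi cancel and those at - xi add up. *)
Theorem Fourier_inversion psi xi : Lizorkin_Psi psi ->
  Fourier (Fourier psi) xi = ((2 * pi) ^+ n)%:C * psi (- xi).
Proof.
move=> Ppsi; have ipsi := Psi_cintegrable Ppsi; move/Lizorkin_PsiP: Ppsi => [f1 f2].
pose u x := complex.Re (psi x); pose v x := complex.Im (psi x).
pose A := fun y => cosine_transform u 0 y + cosine_transform v (pi / 2) y.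
pose B := fun y => cosine_transform v 0 y + cosine_transform u (- (pi / 2)) y.
have FE : Fourier psi = fun y => A y +i* B y.
  by apply/funext => y; exact: FourierE.
have iu d := rintegrable_cosine_transform d f1.
have iv d := rintegrable_cosine_transform d f2.
have iA : rintegrable A by exact: rintegrableD.
have iB : rintegrable B by exact: rintegrableD.
rewrite FE FourierE; last by split.
have TA d : cosine_transform A d xi = (2 * pi) ^+ n / 2 *
    ((cos (0 + d) * u (- xi) + cos (0 - d) * u xi) +
     (cos (pi / 2 + d) * v (- xi) + cos (pi / 2 - d) * v xi)).
  rewrite mulrDr -(flat_inversion xi 0 d f1) -(flat_inversion xi (pi / 2) d f2).
  rewrite -rintD; try exact: rintegrable_cos.
  by apply: eq_rint => y; rewrite mulrDr.
have TB d : cosine_transform B d xi = (2 * pi) ^+ n / 2 *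
    ((cos (0 + d) * v (- xi) + cos (0 - d) * v xi) +
     (cos (- (pi / 2) + d) * u (- xi) + cos (- (pi / 2) - d) * u xi)).
  rewrite mulrDr -(flat_inversion xi 0 d f2) -(flat_inversion xi (- (pi / 2)) d f1).
  rewrite -rintD; try exact: rintegrable_cos.
  by apply: eq_rint => y; rewrite mulrDr.
rewrite /= !TA !TB.
rewrite !add0r !subr0 !addr0 !opprK subrr addNr -!opprD -splitr !cosN cospi.
rewrite cos0 cos_pihalf.
apply/eqP; rewrite eq_complex Re_real_mul Im_real_mul /= -/(u _) -/(v _).
by apply/andP; split; apply/eqP; field.
Qed.

End complex_integral.

(** * The Riesz operator *)

Section Riesz_operator.
Variables (R : realType) (n : nat).
Implicit Types (phi psi : 'rV[R]_n -> R[i]) (xi x y : 'rV[R]_n) (b : R[i]).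

Lemma cpow_gt0D (t s : R) b : 0 < t -> 0 < s -> cpow (t * s) b = cpow t b * cpow s b.
Proof.
move=> t0 s0; rewrite /cpow lnM ?posrE// mulrDr powRM ?ltW//.
rewrite /expi cosD sinD; apply/eqP; rewrite eq_complex /=.
by apply/andP; split; apply/eqP; ring.
Qed.

Lemma cpowN (t : R) b : 0 < t -> cpow t b * cpow t (- b) = 1.
Proof.
move=> t0; case: b => b1 b2; rewrite /cpow /expi /= powRN mulNr cosN sinN.
have p0 : t `^ b1 != 0 by rewrite gt_eqF// powR_gt0.
have := cos2Dsin2 (b2 * ln t).
move: (cos _) (sin _) => c s cs.
apply/eqP; rewrite eq_complex /=.
apply/andP; split; apply/eqP; last by ring.
rewrite -cs; field; exact: p0.
Qed.

Lemma cpow_neq0 (t : R) b : 0 < t -> cpow t b != 0.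
Proof.
by move=> t0; apply/eqP => p0; have := cpowN b t0; rewrite p0 mul0r => /eqP; rewrite eq_sym oner_eq0.
Qed.

Lemma enorm_gt0 x : x != 0 -> 0 < enorm x.
Proof. by move=> x0; rewrite sqrtr_gt0 dotprod_gt0. Qed.

Lemma enorm_scale (t : R) x : 0 <= t -> enorm (t *: x) = t * enorm x.
Proof.
move=> t0; rewrite /enorm dotprodZl dotprodZr mulrA sqrtrM ?mulr_ge0//.
by rewrite -expr2 sqrtr_sqr ger0_norm.
Qed.

Lemma ln_enorm x : x != 0 -> ln (enorm x) = log_enorm x.
Proof.
move=> x0; rewrite /log_enorm -(sqr_sqrtr (dotprod_ge0 x)) -/(enorm x) lnXn ?enorm_gt0//.
by rewrite -[ln _ *+ 2]mulr_natr mulfK// pnatr_eq0.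
Qed.

Definition power_mul b psi : 'rV[R]_n -> R[i] := fun xi => cpow (enorm xi) b * psi xi.

Lemma Lizorkin_Psi0 psi : Lizorkin_Psi psi -> psi 0 = 0.
Proof.
move=> /Lizorkin_PsiP[/flat0 r0 /flat0 i0]; apply/eqP.
by rewrite eq_complex /=; apply/andP; split; apply/eqP.
Qed.

(** The real and imaginary parts of |xi|^b psi are combinations of oscillating
powers and flat functions; at the origin both expressions vanish. *)
Lemma power_mul_Psi b psi : Lizorkin_Psi psi -> Lizorkin_Psi (power_mul b psi).
Proof.
move=> Ppsi; have psi0 := Lizorkin_Psi0 Ppsi; move/Lizorkin_PsiP: Ppsi => [fu fv].
case: b => a c; apply/Lizorkin_PsiP.
have E x : power_mul (a +i* c) psi x =
  (oscillating_power a c 0 x * complex.Re (psi x) +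
   oscillating_power a c (pi / 2) x * complex.Im (psi x)) +i*
  (oscillating_power a c 0 x * complex.Im (psi x) +
   oscillating_power a c (- (pi / 2)) x * complex.Re (psi x)).
  have [->|x0] := eqVneq x 0.
    by rewrite /power_mul psi0 mulr0 !mulr0 !addr0.
  rewrite /power_mul /cpow -mulrA expi_mulE ln_enorm//= /powR gt_eqF ?enorm_gt0// ln_enorm//.
  rewrite /oscillating_power; apply/eqP; rewrite eq_complex Re_real_mul Im_real_mul /=.
  by apply/andP; split; apply/eqP; ring.
split.
- apply: flat_eq (flat_add (flat_oscillating_power a c 0 fu)
    (flat_oscillating_power a c (pi / 2) fv)) => x; by rewrite E.
- apply: flat_eq (flat_add (flat_oscillating_power a c 0 fv)
    (flat_oscillating_power a c (- (pi / 2)) fu)) => x; by rewrite E.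
Qed.

Lemma power_mulK b psi : Lizorkin_Psi psi -> power_mul b (power_mul (- b) psi) = psi.
Proof.
move=> Ppsi; apply/funext => x; rewrite /power_mul.
have [->|x0] := eqVneq x 0; first by rewrite (Lizorkin_Psi0 Ppsi) !mulr0.
by rewrite mulrA cpowN ?mul1r// enorm_gt0.
Qed.

(** By inversion, F (F psi) is (2 pi)^n psi(-.); the factor cancels the one of
the inverse transform, and the reflection xi -> - xi turns the inverse
transform into F, the norm being even. *)
Theorem Riesz_Fourier b psi : Lizorkin_Psi psi ->
  Riesz b (Fourier psi) = Fourier (power_mul b psi).
Proof.
move=> Ppsi; apply/funext => x; rewrite /Riesz /inv_Fourier.
have Pp := power_mul_Psi b Ppsi.
pose G xi := expi (dotprod x xi) * power_mul b psi xi.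
have iG : cintegrable G by exact: cintegrable_expi (Psi_cintegrable Pp).
have m1 : (- 1 : R) != 0 by rewrite oppr_eq0 oner_eq0.
have iG' := cintegrable_scale m1 iG.
rewrite (@eq_integral_Rn _ _ _ (fun xi => ((2 * pi) ^+ n)%:C * G (-1 *: xi))); last first.
  move=> xi; rewrite Fourier_inversion// /G /power_mul scaleN1r dotprodNr.
  have -> : enorm (- xi) = enorm xi by rewrite /enorm dotprodNl dotprodNr opprK.
  by rewrite [in RHS]mulrCA; congr (_ * _); rewrite mulrCA.
rewrite (integral_RnZ _ iG') (integral_Rn_scale m1 iG) normrN normr1 expr1n invr1 mul1r.
rewrite mulrA -rmorphM mulVf ?mul1r//=.
by rewrite expf_neq0// mulf_neq0// gt_eqF// pi_gt0.
Qed.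

Lemma Riesz_Phi b phi : Lizorkin_Phi phi -> Lizorkin_Phi (Riesz b phi).
Proof.
move=> [psi Ppsi <-]; rewrite Riesz_Fourier//.
by exists (power_mul b psi) => //; exact: power_mul_Psi.
Qed.

Lemma Riesz_onto b phi : Lizorkin_Phi phi -> exists2 phi', Lizorkin_Phi phi' & Riesz b phi' = phi.
Proof.
move=> [psi Ppsi <-]; have Pp := power_mul_Psi (- b) Ppsi.
exists (Fourier (power_mul (- b) psi)); first by exists (power_mul (- b) psi).
by rewrite Riesz_Fourier// power_mulK.
Qed.

(** The dilation on the Fourier side, normalised so that the transform of
[dilate t psi] is the transform of psi taken at x / t. *)
Definition dilate (t : R) psi : 'rV[R]_n -> R[i] := fun xi => (t ^+ n)%:C * psi (t *: xi).

Lemma dilate_Psi (t : R) psi : t != 0 -> Lizorkin_Psi psi -> Lizorkin_Psi (dilate t psi).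
Proof.
move=> t0 /Lizorkin_PsiP[fu fv]; apply/Lizorkin_PsiP; split.
  apply: flat_eq (flat_scale (t ^+ n) (flat_dilation t0 fu)) => x.
  by rewrite /dilate Re_real_mul.
apply: flat_eq (flat_scale (t ^+ n) (flat_dilation t0 fv)) => x.
by rewrite /dilate Im_real_mul.
Qed.

Lemma Fourier_dilate (t : R) psi x : 0 < t -> cintegrable psi ->
  Fourier (dilate t psi) x = Fourier psi (t^-1 *: x).
Proof.
move=> t0 ipsi; rewrite /Fourier.
have tn0 : t != 0 by exact: lt0r_neq0.
pose G xi := expi (dotprod (t^-1 *: x) xi) * psi xi.
have iG : cintegrable G by exact: cintegrable_expi.
rewrite (@eq_integral_Rn _ _ _ (fun xi => (t ^+ n)%:C * G (t *: xi))); last first.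
  move=> xi; rewrite /G /dilate.
  have -> : dotprod (t^-1 *: x) (t *: xi) = dotprod x xi.
    by rewrite dotprodZl dotprodZr mulrA mulVf// mul1r.
  by rewrite mulrCA.
rewrite (integral_RnZ _ (cintegrable_scale tn0 iG)) (integral_Rn_scale tn0 iG) gtr0_norm//.
by rewrite mulrA -rmorphM divff ?mul1r//= expf_neq0.
Qed.

Lemma dilate_Phi (t : R) phi : 0 < t -> Lizorkin_Phi phi ->
  Lizorkin_Phi (fun x => phi (t^-1 *: x)).
Proof.
move=> t0 [psi Ppsi <-]; exists (dilate t psi); first exact: dilate_Psi (lt0r_neq0 t0) Ppsi.
by apply/funext => x; rewrite Fourier_dilate//; exact: Psi_cintegrable.
Qed.

Lemma power_mul_dilate (t : R) b psi : 0 < t -> Lizorkin_Psi psi ->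
  power_mul b (dilate t psi) = fun x => cpow t (- b) * dilate t (power_mul b psi) x.
Proof.
move=> t0 Ppsi; apply/funext => x; rewrite /power_mul /dilate.
have [->|x0] := eqVneq x 0; first by rewrite scaler0 (Lizorkin_Psi0 Ppsi) !mulr0.
rewrite enorm_scale ?ltW// cpow_gt0D ?enorm_gt0//.
rewrite -[LHS]mul1r -(cpowN b t0).
move: (cpow t b) (cpow t (- b)) (cpow (enorm x) b) (_%:C) (psi _) => p q r s z.
by ring.
Qed.

(** On the Fourier side this is the homogeneity of |xi|^b. *)
Theorem Riesz_dilate (t : R) b phi : 0 < t -> Lizorkin_Phi phi ->
  Riesz b (fun x => phi (t^-1 *: x)) = fun x => cpow t (- b) * Riesz b phi (t^-1 *: x).
Proof.
move=> t0 [psi Ppsi <-].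
have tn0 := lt0r_neq0 t0.
have FE : (fun x => Fourier psi (t^-1 *: x)) = Fourier (dilate t psi).
  by apply/funext => x; rewrite Fourier_dilate//; exact: Psi_cintegrable.
rewrite FE !Riesz_Fourier//; last exact: dilate_Psi.
apply/funext => x; rewrite power_mul_dilate//.
have Pp := power_mul_Psi b Ppsi.
rewrite -Fourier_dilate//; last exact: Psi_cintegrable.
have id := Psi_cintegrable (dilate_Psi tn0 Pp).
rewrite /Fourier -(integral_RnZ _ (cintegrable_expi x id)).
by apply: eq_integral_Rn => xi; rewrite mulrCA.
Qed.

Lemma dilation_Riesz_dual (t : R) b (f : ('rV[R]_n -> R[i]) -> R[i]) phi : 0 < t ->
  Lizorkin_dual f -> Lizorkin_Phi phi ->
  dilation t (Riesz_dual b f) phi = cpow t (- b) * dilation t f (Riesz b phi).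
Proof.
move=> t0 [lf _] Pphi; rewrite /dilation /Riesz_dual Riesz_dilate//.
have P' := dilate_Phi t0 (Riesz_Phi b Pphi).
have := lf (cpow t (- b)) 0 _ _ P' P'.
rewrite mul0r addr0 => fE; rewrite mulrCA -fE; congr (_ * f _).
by apply/funext => x; rewrite mul0r addr0.
Qed.

Lemma dilation_Riesz_dual_quotient (t : R) b (f : ('rV[R]_n -> R[i]) -> R[i]) phi (c : R[i]) :
  0 < t -> Lizorkin_dual f -> Lizorkin_Phi phi ->
  dilation t (Riesz_dual b f) phi / (cpow t (- b) * c) = dilation t f (Riesz b phi) / c.
Proof.
move=> t0 df Pphi; rewrite dilation_Riesz_dual// invfM mulrACA divff ?mul1r//.
exact: cpow_neq0.
Qed.

End Riesz_operator.

Theorem theorem3p3 (R : realType) (n : nat) (n_gt0 : (0 < n)%N)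
  (f g : ('rV[R]_n -> R[i]) -> R[i])
  (hf : Lizorkin_dual f) (hg : Lizorkin_dual g)
  (rho : R -> R) (hrho : automodel rho) (beta : R[i]) :
  quasi_asymptotic f g (fun t => (rho t)%:C) <->
  quasi_asymptotic (Riesz_dual beta f) (Riesz_dual beta g)
    (fun t => cpow t (- beta) * (rho t)%:C).
Proof.
have quotientE phi : Lizorkin_Phi phi -> {near +oo,
    (fun t => dilation t (Riesz_dual beta f) phi / (cpow t (- beta) * (rho t)%:C)) =1
    (fun t => dilation t f (Riesz beta phi) / (rho t)%:C)}.
  move=> Pphi; have := nbhs_pinfty_gt (num_real (0 : R)).
  by apply: filterS => t t0; exact: dilation_Riesz_dual_quotient.
split=> -[[phi Pphi gphi] cvg]; split.
- have [phi' P' E] := Riesz_onto beta Pphi.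
  by exists phi' => //; rewrite /Riesz_dual E.
- move=> psi Ppsi; apply: cvg_trans (cvg _ (Riesz_Phi beta Ppsi)).
  by apply: near_eq_cvg; apply: filterS (quotientE _ Ppsi) => t /esym.
- by exists (Riesz beta phi); [exact: Riesz_Phi|].
- move=> psi Ppsi; have [phi' P' <-] := Riesz_onto beta Ppsi.
  apply: cvg_trans (cvg _ P'); apply: near_eq_cvg; exact: quotientE.
Qed.
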